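(* There is an algorithm which, given a graph $G$ with $m$ edges, computes the truss decomposition of $G$ (i.e. the value $\tau(e)$ for every edge $e$ of $G$) using $O(m)$ memory and running in time $O(m\,\bar\delta(G))$. Moreover, $O(m\,\bar\delta(G)) \le O(m\,\alpha(G)) \le O(m^{3/2})$, where $\alpha(G)$ is the arboricity of $G$.
   Context: All graphs are finite, simple and undirected, with no isolated vertices; $n$ and $m$ denote the numbers of vertices and edges. Running time and memory are measured in the standard unit-cost random access machine model, in which arrays and adjacency tests $(u,v)\in E$ can be accessed in $O(1)$ time. A $k$-truss is a graph with no isolated vertices in which every edge is contained in at least $k$ triangles. For $L\subseteq E$, $G(L)$ is the graph with edge set $L$ and vertex set the set of endpoints of edges of $L$. A $k$-truss-component of $G$ is a maximal edge set $L\subseteq E$ such that $G(L)$ is a connected $k$-truss. The trussness $\tau(e)$ of an edge $e$ is the largest integer $k$ such that $e$ lies in a $k$-truss-component of $G$. (The $k$-truss-components for any $k$ can be recovered from $\tau$ by depth-first search restricted to edges with $\tau(e)\ge k$; truss decomposition means computing $\tau(e)$ for all $e$.) The average degeneracy of $G$ is $\bar\delta(G)=\frac1m\sum_{e=(u,v)\in E}\min(\deg(u),\deg(v))$. The arboricity $\alpha(G)$ is the minimum number of forests into which the edge set of $G$ can be partitioned. *)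

(* Defs.v *)
From mathcomp Require Import all_boot all_order all_algebra.

Set Implicit Arguments.
Unset Strict Implicit.
Unset Printing Implicit Defensive.

Import Order.TTheory GRing.Theory Num.Theory.

(* MathComp development.  A graph on the vertex type T is given by its edge
   set E : {set {set T}}; an edge uv is the unordered pair [set u; v]. *)

Section Graphs.
Variable T : finType.

(* Finite simple graph with vertex set T and without isolated vertices. *)
Definition graph (E : {set {set T}}) : bool :=
  [forall e in E, #|e| == 2] && (cover E == [set: T]).

Definition adj (L : {set {set T}}) : rel T :=
  [rel x y | (x != y) && ([set x; y] \in L)].

Definition deg (E : {set {set T}}) (x : T) : nat := #|[set y | adj E x y]|.

Definition triangles (L : {set {set T}}) : {set {set T}} :=
  [set t : {set T} | (#|t| == 3) &&
     [forall e : {set T}, (e \subset t) && (#|e| == 2) ==> (e \in L)]].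

(* G(L) has edge set L and vertex set cover L, so it never has isolated
   vertices; only the triangle condition has to be imposed. *)
Definition ktruss (k : nat) (L : {set {set T}}) : bool :=
  [forall e in L, k <= #|[set t in triangles L | e \subset t]|].

Definition connected (L : {set {set T}}) : bool :=
  [forall x in cover L, forall y in cover L, connect (adj L) x y].

Definition ktruss_component (E : {set {set T}}) (k : nat)
    (L : {set {set T}}) : bool :=
  maxset (fun L' : {set {set T}} =>
            [&& L' \subset E, ktruss k L' & connected L']) L.

Definition in_ktruss_component (E : {set {set T}}) (e : {set T}) (k : nat) :=
  exists2 L : {set {set T}}, ktruss_component E k L & e \in L.

Definition is_trussness (E : {set {set T}}) (e : {set T}) (k : nat) : Prop :=
  in_ktruss_component E e k /\
  forall k', in_ktruss_component E e k' -> k' <= k.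

(* No simple cycle of length at least 3; a repetition-free sequence of
   vertices has length at most #|T|, so bounded tuples lose nothing. *)
Definition acyclic (F : {set {set T}}) : bool :=
  [forall k : 'I_#|T|.+1, forall s : k.-tuple T,
     ~~ [&& 2 < k, uniq s & cycle (adj F) s]].

Definition forest_partition (E : {set {set T}}) (k : nat) : bool :=
  [exists P : {set {set {set T}}},
     [&& partition P E, #|P| == k & [forall F in P, acyclic F]]].

Lemma acyclic1 (e : {set T}) : acyclic [set e].
Proof.
apply/forallP => k; apply/forallP => s; apply/negP => /and3P[k2 us cs].
have H x : x \in val s -> (x \in e) && (#|e| == 2).
  move=> xs; have := next_cycle cs xs; rewrite /adj /= in_set1.
  by case/andP=> ne /eqP <-; rewrite set21 cards2 ne.
case: s us cs H => -[|x s] /= sz us cs H.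
  by move: k2; rewrite -(eqP sz).
have /andP[_ /eqP e2] := H x (mem_head _ _).
have : size (x :: s) <= #|e|.
  have /card_uniqP <- : uniq (x :: s) by [].
  apply/subset_leq_card/subsetP => y ys.
  by case/andP: (H y ys).
by rewrite /= e2 (eqP sz) leqNgt k2.
Qed.

Lemma forest_partition_exists (E : {set {set T}}) :
  exists k, forest_partition E k.
Proof.
exists #|[set [set e] | e in E]|; apply/existsP.
exists [set [set e] | e in E]; apply/and3P; split=> //; last first.
  by apply/forallP => F; apply/implyP => /imsetP[e _ ->]; exact: acyclic1.
apply/and3P; split.
- by rewrite cover_imset; apply/eqP; apply/setP => e; apply/bigcupP/idP =>
     [[f fE /set1P ->]//|eE]; exists e => //; exact: set11.
- apply/trivIsetP => _ _ /imsetP[e _ ->] /imsetP[f _ ->] ne.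
  rewrite -setI_eq0; apply/eqP/setP => g; rewrite !inE.
  by apply/negP => /andP[/eqP -> /eqP ef]; rewrite ef eqxx in ne.
- by apply/negP => /imsetP[e _ /setP /(_ e)]; rewrite !inE eqxx.
Qed.

Definition arboricity (E : {set {set T}}) : nat :=
  ex_minn (forest_partition_exists E).

End Graphs.

(* The conditions u < v and adj E u v select each edge exactly once. *)
Definition avg_degeneracy (n : nat) (E : {set {set 'I_n}}) : rat :=
  ((#|E|%:R)^-1 *
   (\sum_(u < n) \sum_(v < n | (u < v) && adj E u v)
      minn (deg E u) (deg E v))%N%:R)%R.

(* Unit-cost random access machine (addition and truncated subtraction on
   natural numbers, indirect addressing), with programs in structured form.
   The finitely many registers named in a program are its O(1) working
   registers; the unbounded memory is addressed by natural numbers and is zero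
   outside of the input.  [Adj] is the unit-time adjacency test. *)

Inductive expr : Type :=
| Cst of nat
| Reg of nat
| Deref of expr
| Plus of expr & expr
| Minus of expr & expr
| Adj of expr & expr.

Inductive cmd : Type :=
| Skip
| Assign of nat & expr
| Store of expr & expr
| Seq of cmd & cmd
| If of expr & cmd & cmd
| While of expr & cmd.

Record state : Type := State { reg : nat -> nat; cell : nat -> nat }.

Definition upd (f : nat -> nat) (a v : nat) : nat -> nat :=
  fun b => if b == a then v else f b.

Fixpoint eval (A : rel nat) (s : state) (x : expr) : nat :=
  match x with
  | Cst c => c
  | Reg r => reg s r
  | Deref a => cell s (eval A s a)
  | Plus x1 x2 => eval A s x1 + eval A s x2
  | Minus x1 x2 => eval A s x1 - eval A s x2
  | Adj x1 x2 => A (eval A s x1) (eval A s x2)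
  end.

Fixpoint ecost (x : expr) : nat :=
  match x with
  | Cst _ | Reg _ => 1
  | Deref a => (ecost a).+1
  | Plus x1 x2 | Minus x1 x2 | Adj x1 x2 => (ecost x1 + ecost x2).+1
  end.

(* Memory cells read by the evaluation of an expression. *)
Fixpoint ecells (A : rel nat) (s : state) (x : expr) : seq nat :=
  match x with
  | Cst _ | Reg _ => [::]
  | Deref a => eval A s a :: ecells A s a
  | Plus x1 x2 | Minus x1 x2 | Adj x1 x2 => ecells A s x1 ++ ecells A s x2
  end.

(* exec A c s s' t l: started in s, the program c halts in s' after t unit-cost
   operations, and l lists the memory cells read or written, with repetitions.
   Nonzero values count as true. *)
Inductive exec (A : rel nat) :
    cmd -> state -> state -> nat -> seq nat -> Prop :=
| ExSkip s : exec A Skip s s 1 [::]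
| ExAssign r x s :
    exec A (Assign r x) s (State (upd (reg s) r (eval A s x)) (cell s))
      (ecost x).+1 (ecells A s x)
| ExStore a x s :
    exec A (Store a x) s
      (State (reg s) (upd (cell s) (eval A s a) (eval A s x)))
      (ecost a + ecost x).+1
      (eval A s a :: ecells A s a ++ ecells A s x)
| ExSeq c1 c2 s1 s2 s3 t1 t2 l1 l2 :
    exec A c1 s1 s2 t1 l1 -> exec A c2 s2 s3 t2 l2 ->
    exec A (Seq c1 c2) s1 s3 (t1 + t2) (l1 ++ l2)
| ExIfTrue x c1 c2 s s' t l :
    eval A s x != 0 -> exec A c1 s s' t l ->
    exec A (If x c1 c2) s s' (ecost x + t).+1 (ecells A s x ++ l)
| ExIfFalse x c1 c2 s s' t l :
    eval A s x = 0 -> exec A c2 s s' t l ->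
    exec A (If x c1 c2) s s' (ecost x + t).+1 (ecells A s x ++ l)
| ExWhileFalse x c s :
    eval A s x = 0 ->
    exec A (While x c) s s (ecost x).+1 (ecells A s x)
| ExWhileTrue x c s1 s2 s3 t1 t2 l1 l2 :
    eval A s1 x != 0 -> exec A c s1 s2 t1 l1 ->
    exec A (While x c) s2 s3 t2 l2 ->
    exec A (While x c) s1 s3 (ecost x + t1 + t2).+1
      (ecells A s1 x ++ l1 ++ l2).

(* Uniform space measure: the number of distinct memory cells used. *)
Definition cells_used (l : seq nat) : nat := size (undup l).

Section Encoding.
Variable n : nat.

Definition adj_test (E : {set {set 'I_n}}) : rel nat :=
  fun i j => [exists u : 'I_n, exists v : 'I_n,
                [&& val u == i, val v == j & adj E u v]].

Definition edges_of (es : seq ('I_n * 'I_n)) : seq {set 'I_n} :=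
  [seq [set p.1; p.2] | p <- es].

(* es lists every edge of E once, in any order and with either orientation. *)
Definition edge_listing (E : {set {set 'I_n}}) (es : seq ('I_n * 'I_n)) :=
  perm_eq (edges_of es) (enum E).

(* Cells 0, 1, 2, ...: n, m, u_0, v_0, u_1, v_1, ..., u_(m-1), v_(m-1). *)
Definition input (es : seq ('I_n * 'I_n)) : state :=
  State (fun=> 0)
    (nth 0 (n :: size es ::
            flatten [seq [:: val p.1; val p.2] | p <- es])).

(* The value for the i-th listed edge is stored just after the input. *)
Definition output (m : nat) (s : state) (i : nat) : nat :=
  cell s (2 + 2 * m + i).

End Encoding.

(* Main.v *)
Require Import Defs.
From mathcomp Require Import all_boot all_order all_algebra.
From mathcomp Require Import zify.
Set Implicit Arguments.
Unset Strict Implicit.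
Unset Printing Implicit Defensive.

(* The algorithm peels edges.  The support of an edge uv (its number of
   triangles) is found by running through the neighbours w of the endpoint of
   smaller degree and testing whether w is adjacent to the other endpoint, in
   time O(min (deg u, deg v)).  In round k, edges of support at most k are
   removed and receive trussness k; each removal lowers by one the support of
   the other two edges of its remaining triangles, and an edge whose support
   drops to k is pushed on a stack.  When round k is over, the remaining edges
   form a (k+1)-truss containing every (k+1)-truss of the graph.  No bucket queue
   is needed: every round may rescan the list of remaining edges, because an edge
   e seen in round k satisfies k <= min deg e, so that all scans together also
   cost the sum of the min deg e.

   For the arboricity bounds: a forest has an injection from its edges to their
   endpoints, so the sum of min deg over a forest is at most the sum of all
   degrees, 2m.  Conversely, orient the edges towards larger degree; out-degrees
   are then at most sqrt (2m), and choosing one out-edge per vertex yields a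
   forest. *)

(** * Programs over fields of memory *)

(** Trussness is defined through maximal connected sets; what reduces it to plain k-trusses is that
    the triangles at an edge never leave its connected component. The neighbour lists describe [E]
    throughout and are never shortened: finding the remaining triangles of a removed edge may cost
    its minimum degree in [E], which is what the time bound allows, and one flag per edge tells
    which edges remain. The list of edges is cleaned lazily as well: a removed edge may stay in it
    until its next scan, which is still within its budget because it was kept for having support
    above k. The adjacency test yields only a bit, so the number of an edge is looked up in a sparse
    table indexed by vertex pairs. Interleaving the fields in memory spares them a length bound, and
    space is measured by the cells touched. Time is split accordingly: loop-free code has a constant
    syntactic cost, and a potential bounds the iterations of the main loop. *)

Inductive hexpr : Type :=
| HCst of nat
| HReg of nat
| HGet of nat & hexpr
| HPlus of hexpr & hexpr
| HMinus of hexpr & hexpr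
| HAdj of hexpr & hexpr.

Inductive hcmd : Type :=
| HSkip
| HSet of nat & hexpr
| HPut of nat & hexpr & hexpr
| HSeq of hcmd & hcmd
| HIf of hexpr & hcmd & hcmd
| HWhile of hexpr & hcmd.

Record hstate : Type := HState { hr : nat -> nat; hf : nat -> nat -> nat }.

Definition updr (r : nat -> nat) (a v : nat) : nat -> nat :=
  fun b => if Nat.eqb b a then v else r b.

Definition updf (F : nat -> nat -> nat) (f x v : nat) : nat -> nat -> nat :=
  fun g y => if Nat.eqb g f && (y == x) then v else F g y.

Definition setr (h : hstate) (r v : nat) : hstate :=
  HState (updr (hr h) r v) (hf h).

Definition putf (h : hstate) (f x v : nat) : hstate :=
  HState (hr h) (updf (hf h) f x v).

(* Fields 0 and 1 are the endpoints of the listed edges in the input and field 2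
   is the output array; the fields f = 3, ..., 11 are interleaved behind them,
   entry x being cell 3 m + f + 2 + 12 x. *)
Definition fcst (f : nat) : nat := nth f.+2 [:: 2; 3; 2] f.
Definition fcoef (f : nat) : nat := nth 3 [:: 0; 0; 2] f.
Definition fstride (f : nat) : nat := nth 12 [:: 2; 2; 1] f.

Definition addr (m f x : nat) : nat := fcst f + fcoef f * m + fstride f * x.

Definition scale (k : nat) (x : expr) : expr := iter k (Plus x) (Cst 0).

(* Register 0 holds the number of edges. *)
Definition addr_expr (f : nat) (x : expr) : expr :=
  Plus (Plus (Cst (fcst f)) (scale (fcoef f) (Reg 0))) (scale (fstride f) x).

Fixpoint cexpr (x : hexpr) : expr :=
  match x with
  | HCst c => Cst c
  | HReg r => Reg r
  | HGet f x1 => Deref (addr_expr f (cexpr x1))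
  | HPlus x1 x2 => Plus (cexpr x1) (cexpr x2)
  | HMinus x1 x2 => Minus (cexpr x1) (cexpr x2)
  | HAdj x1 x2 => Adj (cexpr x1) (cexpr x2)
  end.

Fixpoint ccmd (c : hcmd) : cmd :=
  match c with
  | HSkip => Skip
  | HSet r x => Assign r (cexpr x)
  | HPut f i x => Store (addr_expr f (cexpr i)) (cexpr x)
  | HSeq c1 c2 => Seq (ccmd c1) (ccmd c2)
  | HIf x c1 c2 => If (cexpr x) (ccmd c1) (ccmd c2)
  | HWhile x c1 => While (cexpr x) (ccmd c1)
  end.

Definition tcost (x : hexpr) : nat := (ecost (cexpr x)).+1.

(* A loop is charged for one iteration only. *)
Fixpoint ccost (c : hcmd) : nat :=
  match c with
  | HSkip => 1
  | HSet r x => tcost x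
  | HPut f i x => (ecost (addr_expr f (cexpr i)) + ecost (cexpr x)).+1
  | HSeq c1 c2 => ccost c1 + ccost c2
  | HIf x c1 c2 => tcost x + (ccost c1 + ccost c2)
  | HWhile x c1 => tcost x + ccost c1
  end.

Lemma eval_scale A s k x : eval A s (scale k x) = k * eval A s x.
Proof. by elim: k => //= k ->; rewrite mulSn. Qed.

Lemma ecells_scale A s k x : {subset ecells A s (scale k x) <= ecells A s x}.
Proof.
by elim: k => //= k IH a; rewrite mem_cat => /orP[//|/IH].
Qed.

(** The nine interleaved fields begin 5, ..., 13 cells past [3 * m], hence within one stride of 12,
    so the residue modulo 12 tells the field. The other three end before cell [2 + 3 * m], thanks to
    the bounds on [x] and [y]. *)
Lemma addr_inj m f g x y :
  f < 12 -> g < 12 -> (f <= 2 -> x < m) -> (g <= 2 -> y < m) ->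
  addr m f x = addr m g y -> f = g /\ x = y.
Proof.
have D k : (k < 3 -> [\/ k = 0, k = 1 | k = 2]).
  by case: k => [|[|[|k]]] // _; [exact: Or31|exact: Or32|exact: Or33].
have N k z : 2 < k -> addr m k z = k.+2 + 3 * m + 12 * z.
  by rewrite /addr; case: k => [|[|[|k]]] // _; rewrite /fcst /fcoef /fstride ?nth_default.
move=> f12 g12 fx gy; rewrite /addr.
have [f2|f2] := leqP f 2; have [g2|g2] := leqP g 2.
- move: (fx f2) (gy g2); case: (D f f2) => ->; case: (D g g2) => ->;
    rewrite /fcst /fcoef /fstride /=; lia.
- rewrite -!/(addr _ _ _) (N g) //.
  move: (fx f2); case: (D f f2) => ->; rewrite /addr /fcst /fcoef /fstride /=; lia.
- rewrite -!/(addr _ _ _) (N f) //.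
  move: (gy g2); case: (D g g2) => ->; rewrite /addr /fcst /fcoef /fstride /=; lia.
- rewrite -!/(addr _ _ _) !N //; lia.
Qed.

(** * Program logic with time and space bounds *)

Section Logic.
Variables (A : rel nat) (m : nat) (dom : nat -> nat -> bool) (ok : seq nat).
Hypothesis dom_field : forall f x, dom f x -> f < 12.
Hypothesis dom_bound : forall f x, dom f x -> f <= 2 -> x < m.
Hypothesis dom_ok : forall f x, dom f x -> addr m f x \in ok.

Fixpoint heval (h : hstate) (x : hexpr) : nat :=
  match x with
  | HCst c => c
  | HReg r => hr h r
  | HGet f x1 => hf h f (heval h x1)
  | HPlus x1 x2 => heval h x1 + heval h x2
  | HMinus x1 x2 => heval h x1 - heval h x2
  | HAdj x1 x2 => A (heval h x1) (heval h x2)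
  end.

Fixpoint hsafe (h : hstate) (x : hexpr) : Prop :=
  match x with
  | HCst c => True
  | HReg r => True
  | HGet f x1 => hsafe h x1 /\ dom f (heval h x1)
  | HPlus x1 x2 | HMinus x1 x2 | HAdj x1 x2 => hsafe h x1 /\ hsafe h x2
  end.

(** Only entries in [dom] have to agree; [hsafe] and [wpc] confine all accesses to them, which is
    how [ok] comes to bound the space. *)
Definition rep (s : state) (h : hstate) : Prop :=
  [/\ forall r, reg s r = hr h r,
      reg s 0 = m
    & forall f x, dom f x -> cell s (addr m f x) = hf h f x].

Lemma ecells_addr s f x : {subset ecells A s (addr_expr f x) <= ecells A s x}.
Proof.
by move=> a; rewrite /addr_expr /= mem_cat => /orP[/ecells_scale//|/ecells_scale].
Qed.

Lemma heval_sound s h x : rep s h -> hsafe h x ->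
  eval A s (cexpr x) = heval h x /\ {subset ecells A s (cexpr x) <= ok}.
Proof.
case=> rE m0 cE; elim: x => [c|r|f x IH|x IHx y IHy|x IHx y IHy|x IHx y IHy].
- by [].
- by rewrite /= rE.
- move=> /= [/IH[xE xok] d]; rewrite !eval_scale /= m0 xE -/(addr m f _) cE //.
  split=> // a; rewrite inE => /predU1P[->|]; first exact: dom_ok.
  by move=> H; apply/xok/(@ecells_addr s f).
- move=> /= [/IHx[-> xok] /IHy[-> yok]]; split=> // a.
  by rewrite mem_cat => /orP[/xok|/yok].
- move=> /= [/IHx[-> xok] /IHy[-> yok]]; split=> // a.
  by rewrite mem_cat => /orP[/xok|/yok].
- move=> /= [/IHx[-> xok] /IHy[-> yok]]; split=> // a.
  by rewrite mem_cat => /orP[/xok|/yok].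
Qed.

Definition hwp (c : hcmd) (h : hstate) (b : nat) (Q : hstate -> Prop) : Prop :=
  forall s, rep s h -> exists s' t l,
    [/\ exec A (ccmd c) s s' t l, {subset l <= ok}, t <= b
      & exists2 h', rep s' h' & Q h'].

Lemma hwp_weaken c h b b' (Q Q' : hstate -> Prop) :
  hwp c h b Q -> b <= b' -> (forall h', Q h' -> Q' h') -> hwp c h b' Q'.
Proof.
move=> H bb QQ s /H[s' [t [l [ex lok tb [h' rh /QQ q]]]]].
by exists s', t, l; split=> //; [exact: leq_trans tb bb|exists h'].
Qed.

Lemma hwp_seq c1 c2 h b1 b2 b Q :
  hwp c1 h b1 (fun h' => hwp c2 h' b2 Q) -> b1 + b2 <= b ->
  hwp (HSeq c1 c2) h b Q.
Proof.
move=> H bb s /H[s1 [t1 [l1 [ex1 ok1 tb1 [h1 rh1 H2]]]]].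
have [s2 [t2 [l2 [ex2 ok2 tb2 q]]]] := H2 _ rh1.
exists s2, (t1 + t2), (l1 ++ l2); split=> //; first exact: ExSeq ex1 ex2.
- by move=> a; rewrite mem_cat => /orP[/ok1|/ok2].
- by rewrite (leq_trans _ bb) ?leq_add.
Qed.

Lemma hwp_if x c1 c2 h b1 b2 b Q :
  hsafe h x ->
  (heval h x != 0 -> hwp c1 h b1 Q) -> (heval h x = 0 -> hwp c2 h b2 Q) ->
  tcost x + (b1 + b2) <= b -> hwp (HIf x c1 c2) h b Q.
Proof.
move=> sx H1 H2 bb s rs; have [xE xok] := heval_sound rs sx.
have [x0|x0] := altP (heval h x =P 0).
  have [s' [t [l [ex lok tb q]]]] := H2 x0 _ rs.
  exists s', (ecost (cexpr x) + t).+1, (ecells A s (cexpr x) ++ l); split=> //.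
  - by apply: ExIfFalse ex; rewrite xE.
  - by move=> a; rewrite mem_cat => /orP[/xok|/lok].
  - by move: bb; rewrite /tcost; lia.
have [s' [t [l [ex lok tb q]]]] := H1 x0 _ rs.
exists s', (ecost (cexpr x) + t).+1, (ecells A s (cexpr x) ++ l); split=> //.
- by apply: ExIfTrue ex; rewrite xE.
- by move=> a; rewrite mem_cat => /orP[/xok|/lok].
- by move: bb; rewrite /tcost; lia.
Qed.

(* I b h reads: the loop invariant holds in h and b time units suffice from
   there on; b decreases in each iteration, so the loop terminates. *)
Lemma hwp_while x c (I : nat -> hstate -> Prop) h b Q :
  (forall b h, I b h ->
     [/\ hsafe h x,
         heval h x = 0 -> tcost x <= b /\ Q h
       & heval h x != 0 -> exists b1 b2,
           tcost x + b1 + b2 <= b /\ hwp c h b1 (I b2)]) ->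
  I b h -> hwp (HWhile x c) h b Q.
Proof.
move=> H; elim/ltn_ind: b h => b IH h /H[sx H0 H1] s rs.
have [xE xok] := heval_sound rs sx.
have [x0|x0] := altP (heval h x =P 0).
  have [tb q] := H0 x0; exists s, (tcost x), (ecells A s (cexpr x)); split=> //.
    by apply: ExWhileFalse; rewrite xE.
  by exists h.
have [b1 [b2 [bb H2]]] := H1 x0.
have [s1 [t1 [l1 [ex1 ok1 tb1 [h1 rh1 I1]]]]] := H2 _ rs.
have b2b : b2 < b by move: bb; rewrite /tcost; lia.
have [s2 [t2 [l2 [ex2 ok2 tb2 q]]]] := IH _ b2b _ I1 _ rh1.
exists s2, (ecost (cexpr x) + t1 + t2).+1, (ecells A s (cexpr x) ++ l1 ++ l2).
split=> //.
- by apply: ExWhileTrue ex1 ex2; rewrite xE.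
- by move=> a; rewrite !mem_cat => /or3P[/xok|/ok1|/ok2].
- by move: bb; rewrite /tcost; lia.
Qed.

Lemma hwp_for (hi i N : nat) (P : nat -> hstate -> Prop) (c : nat -> nat) body h b
    (Q : hstate -> Prop) :
  (forall k h, k <= N -> P k h -> hr h hi = N /\ hr h i = k) ->
  (forall k h, k < N -> P k h -> hwp body h (c k) (P k.+1)) ->
  P 0 h -> (forall h, P N h -> Q h) ->
  \sum_(0 <= k < N) (c k + tcost (HMinus (HReg hi) (HReg i))) +
    tcost (HMinus (HReg hi) (HReg i)) <= b ->
  hwp (HWhile (HMinus (HReg hi) (HReg i)) body) h b Q.
Proof.
set t := tcost _ => regs step P0 PN bb.
pose I b h := exists k, [/\ k <= N, P k h & \sum_(k <= j < N) (c j + t) + t <= b].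
apply: (@hwp_while _ _ I); last by exists 0.
move=> {P0 bb h b}b h [k [kN Pk bb]]; have [/= -> ->] := regs _ _ kN Pk.
split=> // [/eqP|]; rewrite subn_eq0 => kN'.
  split; first by apply: leq_trans bb; rewrite leq_addl.
  by apply: PN; have <- : k = N by apply/eqP; rewrite eqn_leq kN.
rewrite -ltnNge in kN'; exists (c k), (\sum_(k.+1 <= j < N) (c j + t) + t).
split; first by move: bb; rewrite big_ltn //; lia.
apply: hwp_weaken (step _ _ kN' Pk) (leqnn _) _ => h' Pk'.
by exists k.+1.
Qed.

Lemma hwp_for_body (hi i N : nat) (P : nat -> hstate -> Prop) body h b
    (Q : hstate -> Prop) :
  (forall k h, k <= N -> P k h -> hr h hi = N /\ hr h i = k) ->
  (forall k h, k < N -> P k h -> hwp body h (ccost body) (P k.+1)) ->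
  P 0 h -> (forall h, P N h -> Q h) ->
  N.+1 * ccost (HWhile (HMinus (HReg hi) (HReg i)) body) <= b ->
  hwp (HWhile (HMinus (HReg hi) (HReg i)) body) h b Q.
Proof.
move=> regs step P0 PN bb; apply: (hwp_for regs step P0 PN).
apply: leq_trans bb; rewrite sum_nat_const_nat /ccost -/ccost; lia.
Qed.

(** Meant for loop-free code; loops go through [hwp_while]. The side condition on assignments
    protects register 0, from which compiled addresses read [m]. *)
Fixpoint wpc (c : hcmd) (h : hstate) (Q : hstate -> Prop) : Prop :=
  match c with
  | HSkip => Q h
  | HSet r x => [/\ r != 0, hsafe h x & Q (setr h r (heval h x))]
  | HPut f i x => [/\ hsafe h i, hsafe h x, dom f (heval h i)
                    & Q (putf h f (heval h i) (heval h x))]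
  | HSeq c1 c2 => wpc c1 h (fun h' => wpc c2 h' Q)
  | HIf x c1 c2 => [/\ hsafe h x, heval h x != 0 -> wpc c1 h Q
                     & heval h x = 0 -> wpc c2 h Q]
  | HWhile x c1 => False
  end.

Lemma wpc_mono c h (Q Q' : hstate -> Prop) :
  (forall h', Q h' -> Q' h') -> wpc c h Q -> wpc c h Q'.
Proof.
elim: c h Q Q' => //= [h Q Q' QQ /QQ//|r x h Q Q' QQ [? ? /QQ]//|
    f i x h Q Q' QQ [? ? ? /QQ]//|
    c1 IH1 c2 IH2 h Q Q' QQ|x c1 IH1 c2 IH2 h Q Q' QQ [sx q1 q2]].
- by apply: IH1 => h' ; apply: IH2.
- by split=> // x0; [apply: IH1 (q1 x0)|apply: IH2 (q2 x0)].
Qed.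

Lemma hwp_wpc c h b Q : wpc c h Q -> ccost c <= b -> hwp c h b Q.
Proof.
elim: c h b Q => [h b Q q|r x h b Q [r0 sx q]|f i x h b Q [si sx d q]|
    c1 IH1 c2 IH2 h b Q q|x c1 IH1 c2 IH2 h b Q [sx q1 q2]|] //= bb.
- move=> s rs; exists s, 1, [::]; split=> //; [exact: ExSkip|by exists h].
- move=> s rs; have [xE xok] := heval_sound rs sx; case: rs => rE m0 cE.
  do 3 eexists; split; [exact: ExAssign|exact: xok|exact: bb|].
  exists (setr h r (heval h x)) => //; rewrite xE; split=> //=.
  + by move=> r'; rewrite /upd /updr rE -eqnE; case: eqnP => [->|/PeanoNat.Nat.eqb_neq ->] //;
      rewrite ?PeanoNat.Nat.eqb_refl.
  + by rewrite /upd eq_sym (negPf r0).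
- move=> s rs; have [xE xok] := heval_sound rs sx.
  have [iE iok] := heval_sound rs si; case: rs => rE m0 cE.
  do 3 eexists; split; [exact: ExStore| |exact: bb|].
    move=> a; rewrite /= !eval_scale /= m0 iE -/(addr m f _) inE mem_cat => /predU1P[->|].
      exact: dom_ok.
    by case/orP=> [H|/xok//]; apply/iok/(@ecells_addr s f).
  exists (putf h f (heval h i) (heval h x)) => //; split=> //= g y dg.
  rewrite !eval_scale /= m0 iE xE -/(addr m f _) /upd /updf.
  (* A store leaves every other entry in [dom] unchanged, because distinct entries have distinct
     addresses. *)
  have [/addr_inj|ne] := altP (addr m g y =P _).
    case=> [||||-> ->]; [exact: dom_field dg|exact: dom_field d|
      exact: dom_bound dg|exact: dom_bound d|].
    by rewrite PeanoNat.Nat.eqb_refl eqxx.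
  rewrite cE //; case: PeanoNat.Nat.eqb_spec => //= gf; case: eqP => // yi.
  by rewrite gf yi eqxx in ne.
- exact: hwp_seq (IH1 _ _ _ (wpc_mono (fun h' q' => IH2 h' _ _ q' (leqnn _)) q) (leqnn _)) bb.
- by apply: (hwp_if sx _ _ bb) => x0; [apply: IH1 (q1 x0) _|apply: IH2 (q2 x0) _].
Qed.

End Logic.

Arguments ccost : simpl never.

(** * Triangles and trusses *)

Section Graph.
Variable T : finType.
Implicit Types (L E : {set {set T}}) (e f g t : {set T}) (u v w x y : T).

Lemma set2_inj u v x y : [set u; v] = [set x; y] ->
  (u = x /\ v = y) \/ (u = y /\ v = x).
Proof.
move=> eq; have: u \in [set x; y] by rewrite -eq set21.
have: v \in [set x; y] by rewrite -eq set22.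
have: x \in [set u; v] by rewrite eq set21.
have: y \in [set u; v] by rewrite eq set22.
rewrite !in_set2 => /orP[]/eqP ? /orP[]/eqP ? /orP[]/eqP ? /orP[]/eqP ?; subst; auto.
Qed.

Lemma eq_set2l u x y : ([set u; x] == [set u; y]) = (x == y).
Proof.
by apply/eqP/eqP => [/set2_inj[[]//|[-> ->]]|->].
Qed.

Lemma adj_sym L : symmetric (adj L).
Proof. by move=> x y; rewrite /adj /= eq_sym setUC. Qed.

Lemma adj_neq L x y : adj L x y -> x != y.
Proof. by case/andP. Qed.

Lemma adj_in L x y : adj L x y -> [set x; y] \in L.
Proof. by case/andP. Qed.

Lemma adjS L L' x y : L \subset L' -> adj L x y -> adj L' x y.
Proof. by move=> /subsetP LL /andP[ne /LL xy]; rewrite /adj /= ne. Qed.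

Lemma graph_edgeP E e : graph E -> e \in E ->
  exists u v, e = [set u; v] /\ adj E u v.
Proof.
case/andP=> /forall_inP E2 _ eE; have /cards2P[u [v [uv eq]]] := E2 _ eE.
by exists u, v; rewrite /adj /= uv -eq.
Qed.

(* A constant that [inE] does not unfold. *)
Definition triangle L t : bool := t \in triangles L.

Lemma triangleP L t :
  reflect (#|t| = 3 /\ forall x y, x \in t -> y \in t -> x != y -> adj L x y)
          (triangle L t).
Proof.
rewrite /triangle inE; apply: (iffP andP) => [[/eqP t3 /forallP H]|[t3 H]].
  split=> // x y xt yt xy; have := H [set x; y].
  rewrite subUset !sub1set xt yt cards2 xy /= => xyL.
  by rewrite /adj /= xy.
split; first by apply/eqP.
apply/forallP => e; apply/implyP => /andP[et /cards2P[x [y [xy eq]]]].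
rewrite eq; apply/adj_in/H => //; apply: (subsetP et); rewrite eq.
  exact: set21.
exact: set22.
Qed.

Lemma triangleS L L' t : L \subset L' -> triangle L t -> triangle L' t.
Proof.
move=> LL /triangleP[t3 H]; apply/triangleP.
by split=> // x y xt yt xy; apply: adjS LL (H _ _ xt yt xy).
Qed.

Definition support L e : nat := #|[set t | triangle L t & e \subset t]|.

Lemma ktrussP k L : reflect (forall e, e \in L -> k <= support L e) (ktruss k L).
Proof. exact: forall_inP. Qed.

Lemma supportS L L' e : L \subset L' -> support L e <= support L' e.
Proof.
move=> LL; apply/subset_leq_card/subsetP => t; rewrite !inE => /andP[tL ->].
by rewrite (triangleS LL tL).
Qed.

Lemma ktruss_leq k k' L : k <= k' -> ktruss k' L -> ktruss k L.
Proof.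
by move=> kk /ktrussP H; apply/ktrussP => e /H; apply: leq_trans.
Qed.

Definition common_nbr L u v : {set T} := [set w | adj L u w && adj L v w].

Lemma common_nbr_triangle L u v w : adj L u v -> w \in common_nbr L u v ->
  triangle L (w |: [set u; v]).
Proof.
move=> uv; rewrite inE => /andP[uw vw]; apply/triangleP; split.
  rewrite cardsU1 cards2 (adj_neq uv) !inE negb_or.
  by rewrite eq_sym (adj_neq uw) eq_sym (adj_neq vw).
move=> x y; rewrite !inE => /or3P[]/eqP-> /or3P[]/eqP-> //;
  rewrite ?eqxx // => _; by rewrite // adj_sym.
Qed.

Lemma triangle_common_nbr L u v t : u != v -> [set u; v] \subset t ->
  triangle L t -> exists2 w, w \in common_nbr L u v & t = w |: [set u; v].
Proof.
move=> uv; rewrite subUset !sub1set => /andP[ut vt] /triangleP[t3 H].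
have : #|t :\: [set u; v]| == 1.
  have st : [set u; v] \subset t by rewrite subUset !sub1set ut vt.
  by rewrite cardsD (setIidPr st) t3 cards2 uv.
case/cards1P => w wE.
have : w \in t :\: [set u; v] by rewrite wE set11.
rewrite !inE negb_or => /andP[/andP[wu wv] wt].
exists w; first by rewrite inE !H // eq_sym.
rewrite -[t in LHS](setID _ [set u; v]) wE setUC; congr (_ :|: _).
by apply/setIidPr; rewrite subUset !sub1set ut.
Qed.

Lemma support_common_nbr L u v : adj L u v ->
  support L [set u; v] = #|common_nbr L u v|.
Proof.
move=> uv; rewrite /support.
have -> : [set t | triangle L t & [set u; v] \subset t] =
          [set w |: [set u; v] | w in common_nbr L u v].
  apply/setP => t; rewrite inE.
  apply/andP/imsetP => [[tL st]|[w wW ->]].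
    by apply: triangle_common_nbr => //; exact: adj_neq uv.
  by rewrite common_nbr_triangle // subsetUr.
apply: card_in_imset => w w'; rewrite !inE => /andP[uw vw] /andP[uw' vw'] eq.
have: w \in w' |: [set u; v] by rewrite -eq !inE eqxx.
rewrite !inE => /or3P[/eqP//|/eqP wu|/eqP wv].
  by move: (adj_neq uw); rewrite wu eqxx.
by move: (adj_neq vw); rewrite wv eqxx.
Qed.

(** Two distinct edges lie in at most one common triangle, namely their union, so deleting [e] costs
    [f] at most one triangle. *)
Lemma support_remove L e f : #|e| = 2 -> #|f| = 2 -> f != e ->
  support L f = support (L :\ e) f + triangle L (e :|: f).
Proof.
move=> e2 f2 fe; rewrite /support.
rewrite -(cardsID [set t : {set T} | e \subset t] [set t | triangle L t & f \subset t]) addnC.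
congr (_ + _).
  apply: eq_card => t; rewrite !inE.
  have [ft|] := boolP (f \subset t); rewrite ?andbF // !andbT.
  apply/andP/idP => [[net tL]|tL'].
    have /triangleP[t3 H] := tL.
    apply/triangleP; split=> // x y xt yt xy.
    rewrite /adj /= xy !inE adj_in ?H // andbT; apply: contra net => /eqP <-.
    by rewrite subUset !sub1set xt.
  split; last exact: triangleS (subsetDl L [set e]) tL'.
  have /triangleP[_ H] := tL'; apply/negP => et.
  have /eqP/cards2P[x [y [xy eq]]] := e2.
  have xt : x \in t by apply: (subsetP et); rewrite eq set21.
  have yt : y \in t by apply: (subsetP et); rewrite eq set22.
  by have := adj_in (H x y xt yt xy); rewrite -eq !inE eqxx.
have ef3 t : #|t| = 3 -> e \subset t -> f \subset t -> t = e :|: f.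
  move=> t3 et ft; apply/esym/eqP; rewrite eqEcard subUset et ft t3 /=.
  have := cardsUI e f; rewrite e2 f2.
  have : #|e :&: f| < 2; last by lia.
  rewrite -e2 proper_card // properEneq subsetIl andbT; apply: contra fe.
  by move/eqP/setIidPl => ef; rewrite eq_sym eqEcard ef e2 f2.
have [efL|efL] := boolP (triangle L _).
  rewrite /= -(cards1 (e :|: f)); apply: eq_card => t; rewrite !inE.
  apply/idP/eqP => [/andP[/andP[/triangleP[t3 _] ft] et]|->].
    exact: ef3.
  by rewrite efL subsetUl subsetUr.
apply/eqP; rewrite cards_eq0; apply/eqP/setP => t; rewrite !inE.
apply/negP => /andP[/andP[tL ft] et]; case/negP: efL.
by have /triangleP[t3 _] := tL; rewrite -(ef3 t).
Qed.

(** Translates the condition of [support_remove] into the third vertex [w], which is what the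
    program enumerates. *)
Lemma union_triangle L u v f : adj L u v -> f \in L -> #|f| = 2 -> f != [set u; v] ->
  triangle L ([set u; v] :|: f) =
  [exists w in common_nbr L u v, (f == [set u; w]) || (f == [set v; w])].
Proof.
move=> uv fL /eqP/cards2P[x [y [xy fE]]] fe; apply/idP/exists_inP.
  move=> tL; have [w wW tE] := triangle_common_nbr (adj_neq uv) (subsetUl _ _) tL.
  exists w => //.
  have xt : x \in [set u; v] :|: f by rewrite fE !inE eqxx !orbT.
  have yt : y \in [set u; v] :|: f by rewrite fE !inE eqxx !orbT.
  move: xt yt xy fe; rewrite tE fE !inE => /or3P[]/eqP-> /or3P[]/eqP->;
    rewrite ?eqxx // ?[[set v; u]]setUC ?eqxx // ?[[set w; _]]setUC ?eqxx ?orbT //.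
move=> [w wW fw]; have := common_nbr_triangle uv wW.
congr (triangle _ _); apply/setP => z.
by case/orP: fw => /eqP->; rewrite !inE; case: (z == u); case: (z == v); case: (z == w).
Qed.

(** The common neighbours of [u] and [v], together with [v] itself, are neighbours of [u]. The
    strictness also yields that minimum degrees are positive. *)
Lemma support_lt_deg L E u v : L \subset E -> adj L u v ->
  support L [set u; v] < minn (deg E u) (deg E v).
Proof.
move=> LE uv; rewrite support_common_nbr // leq_min; apply/andP; split.
  apply: (@leq_trans #|v |: common_nbr L u v|).
    by rewrite cardsU1 inE negb_and [adj L v v]/adj /= eqxx orbT.
  apply/subset_leq_card/subsetP => w; rewrite !inE => /predU1P[->|/andP[uw _]].
    exact: adjS LE uv.
  exact: adjS LE uw.
apply: (@leq_trans #|u |: common_nbr L u v|).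
  by rewrite cardsU1 inE negb_and [adj L u u]/adj /= eqxx.
apply/subset_leq_card/subsetP => w; rewrite !inE => /predU1P[->|/andP[_ uw]].
  by rewrite adj_sym; exact: adjS LE uv.
exact: adjS LE uw.
Qed.

(** Shrink [L] to its edges inside the connected component [C] of [e]. A triangle meeting [C] lies
    in it, so supports do not change, and the resulting connected k-truss extends to a maximal
    one. *)
Lemma in_ktruss_component_intro E L e k :
  (forall f, f \in E -> #|f| = 2) ->
  L \subset E -> ktruss k L -> e \in L -> in_ktruss_component E e k.
Proof.
move=> E2 LE /ktrussP kL eL.
have /eqP/cards2P[u [v [uv eE]]] := E2 _ (subsetP LE _ eL).
pose C := [set x | connect (adj L) u x].
pose L' := [set f in L | f \subset C].
have L'L : L' \subset L by apply/subsetP => f; rewrite inE => /andP[].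
have CC x y : x \in C -> adj L x y -> y \in C.
  rewrite !inE => ux /connect1; exact: connect_trans.
have adjL' x y : x \in C -> adj L x y -> adj L' x y.
  move=> xC xy; case/andP: (xy) => ne xyL; rewrite /adj /= ne inE xyL /=.
  by rewrite subUset !sub1set xC (CC _ _ xC xy).
have kL' : ktruss k L'.
  apply/ktrussP => f; rewrite inE => /andP[fL fC].
  have /eqP/cards2P[a [b [ab fE]]] := E2 _ (subsetP LE _ fL).
  apply: leq_trans (kL _ fL) _; apply/subset_leq_card/subsetP => t.
  rewrite !inE => /andP[tL ft].
  rewrite ft andbT; have {tL} /triangleP[t3 H] := tL.
  have aC : a \in C by apply: (subsetP fC); rewrite fE set21.
  have at_ : a \in t by apply: (subsetP ft); rewrite fE set21.
  have tC x : x \in t -> x \in C.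
    by move=> xt; have [<-//|ne] := eqVneq a x; apply: CC aC (H _ _ at_ xt ne).
  by apply/triangleP; split=> // x y xt yt xy; apply: adjL' (H _ _ xt yt xy); exact: tC.
have conL' x : x \in C -> connect (adj L') u x.
  rewrite inE => ux; have: x \in [set x | (x \in C) && connect (adj L') u x].
    rewrite -(@closed_connect _ (adj L) _ _ u x ux); first by rewrite !inE !connect0.
    apply: intro_closed; first exact/sym_connect_sym/adj_sym.
    move=> y z yz; rewrite !(in_set (fun x => _ && _)) => /andP[yC uy].
    rewrite (CC _ _ yC yz); apply: connect_trans uy (connect1 _); exact: adjL'.
  by rewrite inE => /andP[].
have cL' : connected L'.
  have cvC x : x \in cover L' -> x \in C.
    by case/bigcupP => f; rewrite inE => /andP[_ fC]; apply: (subsetP fC).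
  apply/forall_inP => x /cvC/conL' ux; apply/forall_inP => y /cvC/conL' uy.
  apply: connect_trans uy; rewrite sym_connect_sym //; exact: adj_sym.
have eL' : e \in L'.
  rewrite inE eL eE subUset !sub1set !inE connect0 /= connect1 //.
  by rewrite /adj /= uv -eE.
pose P L0 := [&& L0 \subset E, ktruss k L0 & connected L0].
have PL' : P L' by rewrite /P kL' cL' (subset_trans L'L LE).
have [M mM LM] := maxset_exists PL'.
by exists M => //; exact: (subsetP LM).
Qed.

Lemma is_trussness_intro E L e k :
  (forall f, f \in E -> #|f| = 2) ->
  L \subset E -> ktruss k L -> e \in L ->
  (forall M : {set {set T}}, M \subset E -> ktruss k.+1 M -> e \notin M) ->
  is_trussness E e k.
Proof.
move=> E2 LE kL eL max; split; first exact: in_ktruss_component_intro kL eL.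
move=> k' [M /maxsetP[/and3P[ME kM _] _] eM]; rewrite leqNgt; apply/negP => kk.
by have := max M ME (ktruss_leq kk kM); rewrite eM.
Qed.

(* On an edge this is the minimum of the degrees of its endpoints; [\max] is
   used because [minn] has no unit. *)
Definition min_deg E e : nat := #|T| - \max_(u in e) (#|T| - deg E u).

Lemma min_degE E u v : u != v -> min_deg E [set u; v] = minn (deg E u) (deg E v).
Proof.
move=> uv; rewrite /min_deg big_setU1 ?inE //= big_set1.
have du : deg E u <= #|T| := max_card _; have dv : deg E v <= #|T| := max_card _.
by move: du dv; move: (deg E u) (deg E v) #|T|; lia.
Qed.

Lemma support_lt_min_deg L E e : graph E -> L \subset E -> e \in L ->
  support L e < min_deg E e.
Proof.
move=> gE LE eL; have [u [v [eE uv]]] := graph_edgeP gE (subsetP LE _ eL).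
rewrite eE min_degE ?(adj_neq uv) //; apply: support_lt_deg => //.
by rewrite /adj /= (adj_neq uv) -eE.
Qed.

Lemma min_deg_gt0 E e : graph E -> e \in E -> 0 < min_deg E e.
Proof. by move=> gE eE; apply: leq_ltn_trans (support_lt_min_deg gE (subxx _) eE). Qed.

Lemma card_le_sum_min_deg E : graph E -> #|E| <= \sum_(e in E) min_deg E e.
Proof.
by move=> gE; rewrite -sum1_card; apply: leq_sum => e eE; exact: min_deg_gt0.
Qed.

(** No vertex is isolated, so the edges cover all vertices. This makes arrays indexed by vertices
    affordable in O(m) space and time. *)
Lemma graph_card_vertices E : graph E -> #|T| <= 2 * #|E|.
Proof.
case/andP=> /forall_inP E2 /eqP cE; rewrite -cardsT -cE.
apply: leq_trans (leq_card_cover _) _.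
rewrite mulnC -sum_nat_const; apply: leq_sum => e /E2/eqP -> //.
Qed.

End Graph.

Lemma sum_edges n (E : {set {set 'I_n}}) (F : {set 'I_n} -> nat) : graph E ->
  \sum_(u < n) \sum_(v < n | (u < v) && adj E u v) F [set u; v] =
  \sum_(e in E) F e.
Proof.
move=> gE; rewrite pair_big_dep /=.
pose P := [set p : 'I_n * 'I_n | (p.1 < p.2) && adj E p.1 p.2].
have EP : E = [set [set p.1; p.2] | p in P].
  apply/setP => e; apply/idP/imsetP => [eE|[[u v]]]; last first.
    by rewrite inE => /andP[_ /adj_in] /= uvE ->.
  have [u [v [-> uv]]] := graph_edgeP gE eE.
  have : val u != val v by rewrite (inj_eq val_inj) (adj_neq uv).
  rewrite neq_ltn => /orP[] lt; first by exists (u, v); rewrite // inE /= lt.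
  by exists (v, u); rewrite /= 1?setUC // inE /= lt adj_sym.
rewrite [in RHS]EP big_imset /=.
  by apply: eq_bigl => p; rewrite inE.
move=> [u v] [x y]; rewrite !inE /= => /andP[uv _] /andP[xy _] /set2_inj.
by case=> [[-> ->]//|[eu ev]]; move: uv xy; rewrite eu ev; lia.
Qed.

Lemma avg_degeneracyE n (E : {set {set 'I_n}}) : graph E ->
  (#|E|%:R * avg_degeneracy E = (\sum_(e in E) min_deg E e)%:R :> rat)%R.
Proof.
move=> gE; rewrite /avg_degeneracy -(sum_edges _ gE).
set s := (\sum_(u < n) _)%N; set s' := (\sum_(u < n) _)%N.
have ss : s' = s.
  apply: eq_bigr => u _; apply: eq_bigr => v /andP[_ /adj_neq]; exact: min_degE.
(* For an empty [E] the inverse of zero is zero, and both sides vanish. *)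
rewrite ss; have [E0|E0] := eqVneq #|E| 0; last first.
  by rewrite GRing.mulrA GRing.divff ?GRing.mul1r // Num.Theory.pnatr_eq0.
have -> : s = 0; last by rewrite E0 GRing.mul0r.
by rewrite -ss /s' (sum_edges _ gE) (cards0_eq E0) big_set0.
Qed.

(** * Arboricity *)

Section Forests.
Variable T : finType.
Implicit Types (E F : {set {set T}}) (e f : {set T}) (u v w x y z : T).

Lemma acyclic_cycle F s :
  acyclic F -> 2 < size s -> uniq s -> ~~ cycle (adj F) s.
Proof.
move=> aF s2 us; apply/negP => cs.
have sT : size s < #|T|.+1 by rewrite ltnS -(card_uniqP us) max_card.
have /forallP/(_ (Ordinal sT))/forallP/(_ (in_tuple s)) := aF.
by rewrite /= s2 us cs.
Qed.

Lemma acyclic_intro F :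
  (forall s, 2 < size s -> uniq s -> cycle (adj F) s -> False) -> acyclic F.
Proof.
move=> H; apply/forallP => k; apply/forallP => s; apply/negP => /and3P[k2 us cs].
by apply: (H s); rewrite ?size_tuple.
Qed.

Lemma acyclicS F F' : F' \subset F -> acyclic F -> acyclic F'.
Proof.
move=> FF aF; apply: acyclic_intro => s s2 us cs.
have /negP := acyclic_cycle aF s2 us; apply; case: s cs {s2 us} => //= x s.
by apply: sub_path => a b; apply: adjS.
Qed.

(** Without a leaf every path could be prolonged at its head, since a repeated vertex would close a
    cycle; paths would outgrow the number of vertices. *)
Lemma acyclic_leaf F x0 y0 : acyclic F -> adj F x0 y0 ->
  exists x y, adj F x y /\ forall z, adj F x z -> z = y.
Proof.
move=> aF xy0.
have [/existsP[x /existsP[y /andP[xy /forallP H]]]|/existsPn noleaf] :=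
  boolP [exists x, exists y, adj F x y && [forall z, adj F x z ==> (z == y)]].
  by exists x, y; split=> // z /(implyP (H z))/eqP.
have ext x y : adj F x y -> exists2 z, adj F x z & z != y.
  move=> xy; have /existsPn/(_ y) := noleaf x; rewrite xy /= => /forallPn[z].
  by rewrite negb_imply => /andP[xz zy]; exists z.
have long k : exists x y p,
    [/\ size p = k, path (adj F) x (y :: p) & uniq (x :: y :: p)].
  elim: k => [|k [x [y [p [sz pth un]]]]].
    by exists x0, y0, [::]; rewrite /= xy0 inE (adj_neq xy0).
  have xy : adj F x y by case/andP: pth.
  have [z xz zy] := ext _ _ xy.
  exists z, x, (y :: p); split; [by rewrite /= sz|by rewrite [path _ _ _]/= adj_sym xz|].
  rewrite cons_uniq un andbT !inE !negb_or zy eq_sym (adj_neq xz) /=.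
  (* As [z] is neither [x] nor [y], it lies further along the path, and the cycle closed at [z] has
     at least three vertices. *)
  apply/negP => zp; case/splitPr: zp sz pth un => p1 p2 sz pth un.
  have us : uniq (x :: y :: rcons p1 z).
    by move: un; rewrite -cat_rcons -!cat_cons cat_uniq => /and3P[].
  suff cy : cycle (adj F) (x :: y :: rcons p1 z).
    by have := @acyclic_cycle F _ aF _ us; rewrite cy /= size_rcons => /(_ isT).
  move: pth; rewrite -cat_rcons -cat_cons cat_path => /andP[pth _].
  by rewrite /cycle rcons_path pth /= last_rcons adj_sym xz.
have [x [y [p [sz _ /card_uniqP un]]]] := long #|T|.
by have := max_card (mem (x :: y :: p)); rewrite un /= sz => /ltnW; rewrite ltnn.
Qed.

(* A forest has an injection from its edges to their endpoints, built by
   removing leaves; the degree sum over the chosen endpoints is bounded by the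
   sum over all vertices. *)
Lemma acyclic_sum_min (d : T -> nat) (c : {set T} -> nat) F :
  (forall e, e \in F -> #|e| = 2) -> (forall e u, e \in F -> u \in e -> c e <= d u) ->
  acyclic F -> \sum_(e in F) c e <= \sum_(u in cover F) d u.
Proof.
move: {2}#|F| (leqnn #|F|) => k; elim: k F => [|k IH] F Fk F2 cd aF.
  by move: Fk; rewrite leqn0 => /eqP/cards0_eq->; rewrite big_set0.
have [->|[e0 e0F]] := set_0Vmem F; first by rewrite big_set0.
have /eqP/cards2P[x0 [y0 [xy0 e0E]]] := F2 _ e0F.
have [|x [y [xy leaf]]] := @acyclic_leaf F x0 y0 aF; first by rewrite /adj /= xy0 -e0E.
set e := [set x; y]; have eF : e \in F := adj_in xy.
have xF : x \in cover F by apply/bigcupP; exists e => //; rewrite set21.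
rewrite (big_setD1 e) //= (big_setD1 x xF) /=; apply: leq_add.
  by apply: cd => //; rewrite set21.
have sF : F :\ e \subset F := subsetDl _ _.
apply: leq_trans (IH _ _ _ _ _) _.
- by move: Fk; rewrite (cardsD1 e) eF.
- by move=> f /(subsetP sF); apply: F2.
- by move=> f u /(subsetP sF); apply: cd.
- exact: acyclicS sF aF.
(* [e] is the only edge at the leaf [x], so the remaining forest no longer covers [x], whose weight
   has paid for [e]. *)
have sub : cover (F :\ e) \subset cover F :\ x.
  apply/subsetP => u /bigcupP[f]; rewrite !inE => /andP[fe fF] uf.
  apply/andP; split; last by apply/bigcupP; exists f.
  apply: contra fe => /eqP ux; have /eqP/cards2P[a [b [ab fE]]] := F2 _ fF.
  move: uf; rewrite ux fE in_set2 => /orP[]/eqP xE.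
    by rewrite /e -(leaf b) ?xE // /adj /= ab -fE.
  by rewrite /e -(leaf a) ?xE 1?setUC // /adj /= eq_sym ab setUC -fE.
rewrite [leqRHS](big_setID (cover (F :\ e))) /= (setIidPr sub).
exact: leq_addr.
Qed.

Lemma sum_deg E : graph E -> \sum_u deg E u <= 2 * #|E|.
Proof.
case/andP=> /forall_inP E2 _.
apply: (@leq_trans (\sum_u \sum_(e in E | u \in e) 1)).
  apply: leq_sum => u _; rewrite sum1_card.
  have inj : injective (fun y => [set u; y]) by move=> y z /eqP; rewrite eq_set2l => /eqP.
  rewrite /deg -(card_imset _ inj); apply/subset_leq_card/subsetP => e.
  by case/imsetP=> y; rewrite inE => /adj_in yE ->; rewrite unfold_in yE set21.
rewrite (exchange_big_dep (mem E)) /=; last by move=> u e _ /andP[].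
rewrite mulnC -sum_nat_const; apply: leq_sum => e eE.
by rewrite sum1_card -(eqP (E2 _ eE)); apply/subset_leq_card/subsetP => u;
  rewrite unfold_in eE.
Qed.

Lemma sum_min_deg_arboricity E : graph E ->
  \sum_(e in E) min_deg E e <= 2 * (#|E| * arboricity E).
Proof.
move=> gE; rewrite /arboricity; case: ex_minnP => k /existsP[P /and3P[partP /eqP <- aP]] _.
have /and3P[/eqP covP _ _] := partP.
rewrite (set_partition_big _ partP) /=.
apply: (@leq_trans (\sum_(F in P) 2 * #|E|)); last first.
  by rewrite sum_nat_const mulnC mulnA.
apply: leq_sum => F FP; have sFE : F \subset E by rewrite -covP; apply: bigcup_sup.
apply: leq_trans (sum_deg gE).
apply: leq_trans (@acyclic_sum_min (deg E) (min_deg E) F _ _ _) _.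
- by move=> e /(subsetP sFE) /(graph_edgeP gE)[u [v [-> /adj_neq uv]]]; rewrite cards2 uv.
- move=> e w /(subsetP sFE) /(graph_edgeP gE)[u [v [-> /adj_neq uv]]].
  by rewrite min_degE // in_set2 => /orP[]/eqP->; [exact: geq_minl|exact: geq_minr].
- exact: (forall_inP aP).
by rewrite [leqRHS](bigID (mem (cover F))) /= leq_addr.
Qed.

Lemma arboricity_leq E (P : {set {set {set T}}}) :
  partition P E -> {in P, forall F, acyclic F} -> arboricity E <= #|P|.
Proof.
move=> partP aP; rewrite /arboricity; case: ex_minnP => k _; apply.
by apply/existsP; exists P; rewrite partP eqxx /=; apply/forall_inP.
Qed.

End Forests.

Section DegreeOrder.
Variables (n : nat) (E : {set {set 'I_n}}).
Implicit Types (u v w x y : 'I_n) (c : nat).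

(* Orienting every edge towards the larger rank bounds all out-degrees by
   sqrt (2 m); the edges with a given position among the out-edges of their
   tail then form a forest. *)
Definition rank u : nat := deg E u * n + u.

Definition out_nbr u : {set 'I_n} := [set w | adj E u w && (rank u < rank w)].

Definition forest c : {set {set 'I_n}} :=
  [set e in E | [exists u, exists w, [&& e == [set u; w], w \in out_nbr u &
     index w (enum (out_nbr u)) == c]]].

Lemma rank_inj : injective rank.
Proof.
move=> u v; rewrite /rank => eq; apply: val_inj.
have := congr1 (modn^~ n) eq; rewrite /= !modnMDl !modn_small //.
Qed.

Lemma rank_leq_deg u w : rank u < rank w -> deg E u <= deg E w.
Proof. rewrite /rank; have := ltn_ord u; have := ltn_ord w; nia. Qed.

(** Each out-neighbour of [u] has degree at least that of [u], hence at least the out-degree of [u],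
    and all degrees together add up to at most [2 * #|E|]. *)
Lemma out_nbr_leq u : graph E -> #|out_nbr u| ^ 2 <= 2 * #|E|.
Proof.
move=> gE; apply: leq_trans (sum_deg gE).
rewrite -mulnn -sum_nat_const.
apply: (@leq_trans (\sum_(w in out_nbr u) deg E w)).
  apply: leq_sum => w; rewrite inE => /andP[_ /rank_leq_deg]; apply: leq_trans.
  by apply/subset_leq_card/subsetP => x; rewrite !inE => /andP[].
by rewrite [leqRHS](bigID (mem (out_nbr u))) /= leq_addr.
Qed.

Lemma forest_adj c u w : adj (forest c) u w ->
  (w \in out_nbr u /\ index w (enum (out_nbr u)) = c) \/
  (u \in out_nbr w /\ index u (enum (out_nbr w)) = c).
Proof.
move=> /adj_in; rewrite inE => /andP[_ /existsP[x /existsP[y /and3P[/eqP eq yx /eqP yc]]]].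
by case: (set2_inj eq) => [[-> ->]|[-> ->]]; [left|right].
Qed.

Lemma forest_adj_out c u w : adj (forest c) u w -> rank u <= rank w ->
  w \in out_nbr u /\ index w (enum (out_nbr u)) = c.
Proof.
case/forest_adj=> // -[]; rewrite inE => /andP[_]; lia.
Qed.

(** On a cycle, both neighbours of the vertex of least rank are its out-neighbours, and both stand
    at position [c] of the same list, so they coincide. *)
Lemma forest_acyclic c : acyclic (forest c).
Proof.
apply: acyclic_intro => s s2 us cs.
have [x xs xmin] : exists2 x, x \in s & forall y, y \in s -> rank x <= rank y.
  case: s s2 {us cs} => // a s _.
  by case: (@arg_minnP _ a (mem (a :: s)) rank (mem_head a s)) => x xs H; exists x.
have [i s' rE] := rot_to xs.
move: s2 us cs; rewrite -(size_rot i) -(rot_uniq i) -(rot_cycle i) rE.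
have {}xmin y : y \in s' -> rank x <= rank y.
  by move=> ys; apply: xmin; rewrite -(mem_rot i) rE inE ys orbT.
case: s' {rE} xmin => // y s' xmin s2 us; rewrite /cycle rcons_path => /andP[/= /andP[xy _]].
set z := last y s'; rewrite adj_sym => xz.
have zs : z \in s' by rewrite /z; case: s' {xmin us xz z} s2 => //= a s' _; rewrite mem_last.
have [yo yc] := forest_adj_out xy (xmin _ (mem_head _ _)).
have [|zo zc] := forest_adj_out xz _; first by apply: xmin; rewrite inE zs orbT.
have yz : y = z.
  rewrite -(nth_index y (s := enum (out_nbr x)) (x := y)) ?mem_enum // yc -zc.
  by rewrite nth_index ?mem_enum.
by move: us; rewrite /= yz zs /= andbF.
Qed.

Lemma arboricity_sqr_leq : graph E -> arboricity E ^ 2 <= 2 * #|E|.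
Proof.
move=> gE; pose D := \max_u #|out_nbr u|.
have D2 : D ^ 2 <= 2 * #|E|.
  have [n0|n0] := posnP n.
    rewrite /D big1 // => u; by have := ltn_ord u; rewrite {2}n0.
  rewrite /D; have [|u ->] := @eq_bigmax 'I_n (fun u => #|out_nbr u|); last exact: out_nbr_leq.
  by rewrite card_ord.
apply: leq_trans D2; rewrite leq_sqr.
(* A partition has no empty block; discarding [set0] avoids showing that every position is taken. *)
pose P := [set forest c | c : 'I_D] :\ set0.
apply: (@leq_trans #|P|); last first.
  apply: leq_trans (subset_leq_card (subsetDl _ _)) _.
  by apply: leq_trans (leq_imset_card _ _) _; rewrite card_ord.
apply: arboricity_leq; last first.
  by move=> F; rewrite !inE => /andP[_ /imsetP[c _ ->]]; exact: forest_acyclic.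
apply/and3P; split; last by rewrite !inE eqxx.
  apply/eqP/setP => e; apply/bigcupP/idP => [[F]|eE].
    by rewrite !inE => /andP[_ /imsetP[c _ ->]]; rewrite inE => /andP[].
  have [c ce] : exists c : 'I_D, e \in forest c.
    have [u [w [eE' uw]]] : exists u w, e = [set u; w] /\ w \in out_nbr u.
      have [u [v [-> uv]]] := graph_edgeP gE eE.
      have : rank u != rank v by rewrite (inj_eq rank_inj) (adj_neq uv).
      rewrite neq_ltn => /orP[] lt; first by exists u, v; rewrite inE uv.
      by exists v, u; rewrite inE adj_sym uv setUC.
    have lt : index w (enum (out_nbr u)) < D.
      apply: (@leq_trans #|out_nbr u|); first by rewrite cardE index_mem mem_enum.
      by apply: (@leq_bigmax _ (fun u => #|out_nbr u|)).
    exists (Ordinal lt); rewrite inE eE; apply/existsP; exists u; apply/existsP; exists w.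
    by rewrite eE' uw !eqxx.
  exists (forest c) => //; rewrite !inE; apply/andP; split; last exact: imset_f.
  by apply/set0Pn; exists e.
(* An edge common to two forests has the same tail in both, since the ranks forbid the opposite
   orientation; its position there determines the forest. *)
apply/trivIsetP => _ _ /setD1P[_ /imsetP[c _ ->]] /setD1P[_ /imsetP[c' _ ->]].
apply: contraNT => /pred0Pn[e /= /andP[]]; rewrite !inE.
case/andP=> _ /existsP[u /existsP[w /and3P[/eqP-> uw /eqP wc]]].
case/andP=> _ /existsP[x /existsP[y /and3P[/eqP/set2_inj eq xy /eqP yc]]].
apply/eqP; congr forest; rewrite -wc -yc.
case: eq => [[-> ->]//|[ux wy]]; move: uw xy; rewrite ux wy !inE.
by case/andP=> _ ? /andP[_]; lia.
Qed.

End DegreeOrder.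

(** Squared, the claim is [m ^ 2 * a ^ 2 <= 4 * m ^ 3], which follows from [a ^ 2 <= 2 * m]; the
    factor 2 is the square root of 2 rounded up. *)
Lemma arboricity_sqrt_leq (R : rcfType) n (E : {set {set 'I_n}}) : graph E ->
  (#|E|%:R * (arboricity E)%:R <= 2%:R * Num.sqrt (#|E|%:R ^+ 3) :> R)%R.
Proof.
move=> gE; have := arboricity_sqr_leq gE.
set a := arboricity E; set m := #|E| => am.
rewrite -(@Num.Theory.ler_pXn2r _ 2) // ?Num.Theory.nnegrE; first last.
- by rewrite Num.Theory.mulr_ge0 ?Num.Theory.ler0n ?Num.Theory.sqrtr_ge0.
- by rewrite Num.Theory.mulr_ge0 ?Num.Theory.ler0n.
rewrite !GRing.exprMn Num.Theory.sqr_sqrtr ?Num.Theory.exprn_ge0 ?Num.Theory.ler0n //.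
rewrite -!GRing.natrX -!GRing.natrM Num.Theory.ler_nat.
by rewrite [m ^ 3]expnS mulnA [leqRHS]mulnC mulnC mulnA; nia.
Qed.

(** * The peeling algorithm *)

(* [rE] holds the current edge [rU] [rV], [rW] is one more than the current
   neighbour of [rU], and [rK] is the round.  [rI], [rJ], [rA] delimit the two
   parts of the list [fLst], and [rS] is the height of the stack [fStk]. *)
Notation rM := 0 (only parsing).
Notation rN := 1 (only parsing).
Notation rI := 2 (only parsing).
Notation rJ := 3 (only parsing).
Notation rA := 4 (only parsing).
Notation rS := 5 (only parsing).
Notation rK := 6 (only parsing).
Notation rE := 7 (only parsing).
Notation rU := 8 (only parsing).
Notation rV := 9 (only parsing).
Notation rW := 10 (only parsing).
Notation rF := 11 (only parsing).
Notation rG := 12 (only parsing).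
Notation rX := 13 (only parsing).

(* [fNext] and [fId] are indexed by [code u w]: they form sparse n x n arrays of
   which only the entries with uw an edge are ever touched, hence O(m) cells.
   [fHead] and [fNext] link the neighbours of a vertex, shifted by one so that
   zero ends the list; [fMul] tabulates the multiples of n, since the machine
   cannot multiply. *)
Notation fU := 0 (only parsing).
Notation fV := 1 (only parsing).
Notation fOut := 2 (only parsing).
Notation fMul := 3 (only parsing).
Notation fDeg := 4 (only parsing).
Notation fHead := 5 (only parsing).
Notation fNext := 6 (only parsing).
Notation fId := 7 (only parsing).
Notation fSup := 8 (only parsing).
Notation fRem := 9 (only parsing).
Notation fLst := 10 (only parsing).
Notation fStk := 11 (only parsing).

Notation "c1 ;; c2" := (HSeq c1 c2) (at level 95, right associativity).

Definition incr (r : nat) : hcmd := HSet r (HPlus (HReg r) (HCst 1)).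

Definition mul_loop : hcmd :=
  HWhile (HMinus (HReg rN) (HReg rI))
    (HPut fMul (HReg rI) (HReg rX) ;;
     HSet rX (HPlus (HReg rX) (HReg rN)) ;;
     incr rI).

(** A push at the front of a neighbour list. The link can be stored under the vertex pair because
    each oriented edge occurs in one list, once. *)
Definition link (u v : nat) : hcmd :=
  let c := HPlus (HGet fMul (HReg u)) (HPlus (HReg v) (HCst 1)) in
  HPut fNext c (HGet fHead (HReg u)) ;;
  HPut fHead (HReg u) (HPlus (HReg v) (HCst 1)) ;;
  HPut fId c (HReg rI) ;;
  HPut fDeg (HReg u) (HPlus (HGet fDeg (HReg u)) (HCst 1)).

Definition link_body : hcmd :=
  HSet rU (HGet fU (HReg rI)) ;; HSet rV (HGet fV (HReg rI)) ;;
  link rU rV ;; link rV rU ;; incr rI.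

Definition link_loop : hcmd :=
  HWhile (HMinus (HReg rM) (HReg rI)) link_body.

(** The truncated difference is nonzero exactly when the first endpoint has the larger degree; the
    swap then gives [rU] the shorter list. *)
Definition traverse_init : hcmd :=
  HSet rU (HGet fU (HReg rE)) ;; HSet rV (HGet fV (HReg rE)) ;;
  HIf (HMinus (HGet fDeg (HReg rU)) (HGet fDeg (HReg rV)))
    (HSet rX (HReg rU) ;; HSet rU (HReg rV) ;; HSet rV (HReg rX)) HSkip ;;
  HSet rW (HGet fHead (HReg rU)).

Definition traverse_step (body : hcmd) : hcmd :=
  HIf (HAdj (HMinus (HReg rW) (HCst 1)) (HReg rV)) body HSkip ;;
  HSet rW (HGet fNext (HPlus (HGet fMul (HReg rU)) (HReg rW))).

Definition traverse (body : hcmd) : hcmd :=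
  traverse_init ;; HWhile (HReg rW) (traverse_step body).

Definition count_body : hcmd :=
  HPut fSup (HReg rE) (HPlus (HGet fSup (HReg rE)) (HCst 1)).

Definition count_step : hcmd :=
  HPut fLst (HReg rE) (HReg rE) ;; traverse count_body ;; incr rE.

Definition count_loop : hcmd :=
  HWhile (HMinus (HReg rM) (HReg rE)) count_step.

Definition push (r : nat) : hcmd := HPut fStk (HReg rS) (HReg r) ;; incr rS.

(** The two truncated differences add up to zero exactly when the new support equals [rK]. Pushing
    on equality only keeps an edge already on the stack from being pushed again. *)
Definition decr (r : nat) : hcmd :=
  HPut fSup (HReg r) (HMinus (HGet fSup (HReg r)) (HCst 1)) ;;
  HIf (HPlus (HMinus (HGet fSup (HReg r)) (HReg rK))
             (HMinus (HReg rK) (HGet fSup (HReg r)))) HSkip (push r).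

Definition peel_body : hcmd :=
  HSet rF (HGet fId (HPlus (HGet fMul (HReg rU)) (HReg rW))) ;;
  HSet rG (HGet fId (HPlus (HGet fMul (HReg rV)) (HReg rW))) ;;
  HIf (HPlus (HGet fRem (HReg rF)) (HGet fRem (HReg rG))) HSkip
    (decr rF ;; decr rG).

Definition pop_init : hcmd :=
  HSet rS (HMinus (HReg rS) (HCst 1)) ;;
  HSet rE (HGet fStk (HReg rS)) ;;
  HPut fRem (HReg rE) (HCst 1) ;;
  HPut fOut (HReg rE) (HReg rK).

(** The list is compacted in place, the write position [rJ] staying behind [rI]; removed edges are
    dropped here. *)
Definition scan : hcmd :=
  HSet rE (HGet fLst (HReg rI)) ;; incr rI ;;
  HIf (HGet fRem (HReg rE)) HSkip
    (HIf (HMinus (HGet fSup (HReg rE)) (HReg rK))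
      (HPut fLst (HReg rJ) (HReg rE) ;; incr rJ)
      (push rE)).

Definition next_round : hcmd :=
  HSet rA (HReg rJ) ;; HSet rI (HCst 0) ;; HSet rJ (HCst 0) ;; incr rK.

Definition main_init : hcmd :=
  HSet rA (HReg rM) ;; HSet rI (HCst 0) ;; HSet rJ (HCst 0) ;;
  HSet rS (HCst 0) ;; HSet rK (HCst 0).

(** The stack has priority, so a scan step always finds it empty. Flattening rounds, scans and
    removals into one loop lets a single potential bound all iterations. *)
Definition main_loop : hcmd :=
  HWhile (HPlus (HReg rS) (HReg rA))
    (HIf (HReg rS) (pop_init ;; traverse peel_body)
       (HIf (HMinus (HReg rA) (HReg rI)) scan next_round)).

Definition truss_prog : hcmd :=
  HSet rI (HCst 0) ;; HSet rX (HCst 0) ;; mul_loop ;;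
  HSet rI (HCst 0) ;; link_loop ;;
  HSet rE (HCst 0) ;; count_loop ;;
  main_init ;; main_loop.

(** * Numbering of the edges and memory layout *)

Section Correctness.
Variables (n : nat) (E : {set {set 'I_n}}) (es : seq ('I_n * 'I_n)).
Hypotheses (gE : graph E) (esE : edge_listing E es).
Implicit Types (u v w : 'I_n) (e : {set 'I_n}) (h : hstate).
Notation m := (size es).

Definition edge_at i : {set 'I_n} := nth set0 (edges_of es) i.
Definition edge_id e : nat := index e (edges_of es).

Lemma mem_edges : edges_of es =i E.
Proof. by move=> e; rewrite (perm_mem esE) mem_enum. Qed.

Lemma card_edges : #|E| = m.
Proof. by rewrite cardE -(perm_size esE) size_map. Qed.

Lemma uniq_edges : uniq (edges_of es).
Proof. by rewrite (perm_uniq esE) enum_uniq. Qed.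

Lemma edge_id_lt e : e \in E -> edge_id e < m.
Proof. by rewrite -mem_edges -index_mem size_map. Qed.

Lemma edge_idK e : e \in E -> edge_at (edge_id e) = e.
Proof. by rewrite -mem_edges; apply: nth_index. Qed.

Lemma edge_atK i : i < m -> edge_id (edge_at i) = i.
Proof. by move=> im; apply: index_uniq uniq_edges; rewrite size_map. Qed.

Lemma edge_at_in i : i < m -> edge_at i \in E.
Proof. by move=> im; rewrite -mem_edges mem_nth // size_map. Qed.

Lemma edge_id_eq e f : e \in E -> f \in E -> (edge_id e == edge_id f) = (e == f).
Proof.
move=> eE fE; apply/eqP/eqP => [/(congr1 edge_at)|->//]; by rewrite !edge_idK.
Qed.

Definition src i : nat := nth 0 [seq val p.1 | p <- es] i.
Definition tgt i : nat := nth 0 [seq val p.2 | p <- es] i.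

Lemma edge_atP i : i < m -> exists u v,
  [/\ src i = u, tgt i = v, edge_at i = [set u; v], adj E u v
    & take i.+1 es = rcons (take i es) (u, v)].
Proof.
move=> im; have := edge_at_in im.
have [p0 _] : exists p0, p0 \in es by case: es im => // p s _; exists p; rewrite mem_head.
rewrite /src /tgt /edge_at !(nth_map p0) //.
case pE : (nth p0 es i) => [u v] /= uvE; exists u, v.
split=> //; last by rewrite (take_nth p0) // pE.
have [x [y [eq xy]]] := graph_edgeP gE uvE.
rewrite /adj /= uvE andbT; have := congr1 (fun e => #|e|) eq.
by rewrite !cards2 (adj_neq xy); case: (u != v).
Qed.

(** Latest first, because linking prepends to the neighbour lists. *)
Definition halves i : seq ('I_n * 'I_n) :=
  rev (flatten [seq [:: (p.1, p.2); (p.2, p.1)] | p <- take i es]).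

Definition nbrs (H : seq ('I_n * 'I_n)) u : seq 'I_n :=
  [seq p.2 | p <- H & p.1 == u].

Lemma mem_nbrs H u w : (w \in nbrs H u) = ((u, w) \in H).
Proof.
apply/mapP/idP => [[[a b]]|uwH].
  by rewrite mem_filter /= => /andP[/eqP-> abH] ->.
by exists (u, w); rewrite // mem_filter eqxx.
Qed.

Lemma uniq_nbrs H u : uniq H -> uniq (nbrs H u).
Proof.
move=> uH; rewrite map_inj_in_uniq ?filter_uniq // => -[a b] [c d].
by rewrite !mem_filter /= => /andP[/eqP-> _] /andP[/eqP-> _] ->.
Qed.

Lemma halvesS i u v : take i.+1 es = rcons (take i es) (u, v) ->
  halves i.+1 = (v, u) :: (u, v) :: halves i.
Proof. by rewrite /halves => ->; rewrite map_rcons flatten_rcons rev_cat. Qed.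

Lemma mem_halves i u v : i <= m -> (u, v) \in halves i ->
  exists2 j, j < i & edge_at j = [set u; v].
Proof.
elim: i => [|i IH] im; first by rewrite /halves take0.
have [x [y [_ _ eq _ /halvesS ->]]] := edge_atP im.
rewrite !inE => /or3P[/eqP[-> ->]|/eqP[-> ->]|/IH[|j ji <-]]; last by exists j => //; lia.
- by exists i; rewrite // eq setUC.
- by exists i.
- exact: ltnW.
Qed.

Lemma halves_new i u v : i < m -> edge_at i = [set u; v] -> (u, v) \notin halves i.
Proof.
move=> im eq; apply/negP => /mem_halves[|j ji]; first exact: ltnW.
rewrite -eq => /(congr1 edge_id); rewrite !edge_atK //; lia.
Qed.

Lemma uniq_halves i : i <= m -> uniq (halves i).
Proof.
elim: i => [|i IH] im; first by rewrite /halves take0.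
have [u [v [_ _ eq uv /halvesS ->]]] := edge_atP im.
have eq' : edge_at i = [set v; u] by rewrite eq setUC.
rewrite [uniq _]/= inE negb_or (halves_new im eq') (halves_new im eq) (IH (ltnW im)) !andbT.
apply/negP => /eqP[vu _]; by move: (adj_neq uv); rewrite vu eqxx.
Qed.

Lemma halves_subset i j p : i <= j -> j <= m -> p \in halves i -> p \in halves j.
Proof.
move=> ij; rewrite -(subnKC ij); elim: (j - i) => [|d IH]; first by rewrite addn0.
rewrite addnS => dm pi; have [u [v [_ _ _ _ /halvesS ->]]] := edge_atP dm.
by rewrite !inE IH ?orbT // ltnW.
Qed.

Lemma adj_halves u v : ((u, v) \in halves m) = adj E u v.
Proof.
apply/idP/idP => [/mem_halves[//|j jm eq]|uv].
  have [x [y [_ _ eq' xy _]]] := edge_atP jm; move: xy.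
  rewrite eq in eq'; case: (set2_inj eq') => -[-> ->] //; by rewrite adj_sym.
have em := edge_id_lt (adj_in uv).
have [x [y [_ _ eq' xy /halvesS eq]]] := edge_atP em.
apply: (halves_subset em (leqnn _)); rewrite eq !inE.
move: eq'; rewrite edge_idK ?(adj_in uv) // => /set2_inj[] [-> ->];
by rewrite eqxx ?orbT.
Qed.

(** The shift matches [rW], which holds one more than the neighbour: the entry of [fMul] at [u] plus
    [rW] is the index. *)
Definition code (u w : nat) : nat := u * n + w.+1.

Lemma code_eq u w u' w' : (code u w == code u' w') = (u == u') && (w == w').
Proof.
apply/eqP/andP => [|[/eqP-> /eqP->]//]; rewrite /code !addnS => -[eq].
have n0 : 0 < n := leq_ltn_trans (leq0n w) (ltn_ord w).
have ew : w = w' :> nat.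
  by have := congr1 (modn^~ n) eq; rewrite /= !modnMDl !modn_small.
have := congr1 (divn^~ n) eq; rewrite /= !divnMDl // !divn_small // !addn0 => eu.
by split; apply/eqP/val_inj.
Qed.

Definition codes : seq nat :=
  flatten [seq [:: code p.1 p.2; code p.2 p.1] | p : 'I_n * 'I_n <- es].

Lemma size_codes : size codes = 2 * m.
Proof.
rewrite size_flatten /shape -map_comp /= (eq_map (g := fun=> 2)) //.
by rewrite sumnE big_map big_const_seq count_predT iter_addn_0.
Qed.

Lemma code_in_codes u v : adj E u v -> code u v \in codes.
Proof.
rewrite -adj_halves mem_rev => /flatten_mapP[p]; rewrite take_size => pes uvp.
apply/flatten_mapP; exists p => //; move: uvp; rewrite !inE.
by case/orP => /eqP[-> ->]; rewrite eqxx ?orbT.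
Qed.

Definition dom (f x : nat) : bool :=
  match f with
  | fU | fV | fOut | fSup | fRem | fLst | fStk => x < m
  | fMul | fDeg | fHead => x < n
  | fNext | fId => x \in codes
  | _ => false
  end.

Definition block (fs xs : seq nat) : seq nat :=
  [seq addr m f x | f <- fs, x <- xs].

Lemma mem_block fs xs (f x : nat) : f \in fs -> x \in xs -> addr m f x \in block fs xs.
Proof. by move=> ff xx; apply/allpairsP; exists (f, x). Qed.

Definition cells : seq nat :=
  [:: 0; 1] ++ block [:: fU; fV; fOut; fSup; fRem; fLst; fStk] (iota 0 m) ++
  block [:: fMul; fDeg; fHead] (iota 0 n) ++ block [:: fNext; fId] codes.

Lemma size_cells : size cells = 2 + (7 * m + (3 * n + 2 * (2 * m))).
Proof. by rewrite /cells 3!size_cat !size_allpairs !size_iota size_codes. Qed.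

Lemma dom_field (f x : nat) : dom f x -> f < 12.
Proof. by case: f; do 12?case=> //. Qed.

Lemma dom_bound (f x : nat) : dom f x -> f <= 2 -> x < m.
Proof. by move=> + f2; case: f f2; do 3?case=> //. Qed.

Lemma dom_ok (f x : nat) : dom f x -> addr m f x \in cells.
Proof.
move=> d; rewrite /cells mem_cat; apply/orP; right.
rewrite mem_cat; have [f1|f1] := boolP (f \in [:: fU; fV; fOut; fSup; fRem; fLst; fStk]).
  rewrite (mem_block f1) // mem_iota add0n /=.
  by case: f f1 d => [|[|[|[|[|[|[|[|[|[|[|[|f]]]]]]]]]]]].
apply/orP; right; rewrite mem_cat; have [f2|f2] := boolP (f \in [:: fMul; fDeg; fHead]).
  rewrite (mem_block f2) // mem_iota add0n /=.
  by case: f {f1} f2 d => [|[|[|[|[|[|[|[|[|[|[|[|f]]]]]]]]]]]].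
apply/orP; right; have [f3|f3] := boolP (f \in [:: fNext; fId]).
  rewrite (mem_block f3) //.
  by case: f {f1 f2} f3 d => [|[|[|[|[|[|[|[|[|[|[|[|f]]]]]]]]]]]].
by case: f f1 f2 f3 d => [|[|[|[|[|[|[|[|[|[|[|[|f]]]]]]]]]]]].
Qed.

Lemma adj_testE u v : adj_test E u v = adj E u v.
Proof.
apply/existsP/idP => [[x /existsP[y /and3P[/eqP/val_inj-> /eqP/val_inj->]]]//|uv].
by exists u; apply/existsP; exists v; rewrite !eqxx.
Qed.

Lemma deg_nbrs u : size (nbrs (halves m) u) = deg E u.
Proof.
rewrite -(card_uniqP (uniq_nbrs u (uniq_halves (leqnn m)))).
by apply: eq_card => w; rewrite !inE mem_nbrs adj_halves.
Qed.

Notation swp := (wpc (adj_test E) dom).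
Notation twp := (hwp (adj_test E) m dom cells).

Definition twp_swp := @hwp_wpc (adj_test E) m dom cells dom_field dom_bound dom_ok.
Definition twp_while := @hwp_while (adj_test E) m dom cells dom_ok.
Definition twp_for_body := @hwp_for_body (adj_test E) m dom cells dom_ok.
Definition twp_for := @hwp_for (adj_test E) m dom cells dom_ok.
Definition twp_if := @hwp_if (adj_test E) m dom cells dom_ok.

(** * Building and traversing the adjacency lists *)

Definition ptr (s : seq 'I_n) : nat := if s is w :: _ then w.+1 else 0.

Definition input_ok h : Prop :=
  hr h rM = m /\ (forall i, i < m -> hf h fU i = src i /\ hf h fV i = tgt i).

Definition mul_ok h : Prop := forall u, hf h fMul u = u * n.

Definition links (H : seq ('I_n * 'I_n)) h : Prop :=
  [/\ forall u, hf h fDeg u = size (nbrs H u),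
      forall u, hf h fHead u = ptr (nbrs H u),
      forall u pre w rest, nbrs H u = pre ++ w :: rest ->
        hf h fNext (code u w) = ptr rest
    & forall u w, (u, w) \in H -> hf h fId (code u w) = edge_id [set u; w]].

Lemma link_spec ru rv H u v h (Q : hstate -> Prop) :
  input_ok h -> mul_ok h -> links H h -> hr h ru = u -> hr h rv = v ->
  adj E u v -> (u, v) \notin H -> hr h rI = edge_id [set u; v] ->
  (forall h', input_ok h' -> mul_ok h' -> links ((u, v) :: H) h' -> hr h' = hr h ->
     hf h' fSup = hf h fSup -> hf h' fRem = hf h fRem -> Q h') ->
  swp (link ru rv) h Q.
Proof.
move=> ih mh [dH hH nH iH] eu ev uv new ei HQ.
have cuv := code_in_codes uv.
have cE : hf h 3 u + (v + 1) = code u v by rewrite mh addn1.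
rewrite /= /putf /updf /= eu ev ei cE; do !split=> //; try exact: ltn_ord.
apply: HQ => //; split=> [x|x|x pre w rest|x w] /=.
- rewrite (inj_eq val_inj) eq_sym /nbrs /=; case: eqP => [->|] //=.
  by rewrite dH addn1.
- rewrite (inj_eq val_inj) eq_sym /nbrs /=; case: eqP => [->|] //=.
  by rewrite addn1.
- rewrite code_eq /nbrs /=; have [xu|ux] := eqVneq x u;
    rewrite 1?eq_sym ?xu ?eqxx ?(negPf ux) /= => eq.
    case: pre eq => [|a pre] [va eq]; first by rewrite va eqxx hH -eq.
    have wH : (u, w) \in H by rewrite -mem_nbrs /nbrs eq mem_cat mem_head orbT.
    have [wv|_] := eqVneq w v; last exact: nH eq.
    by case/negP: new; rewrite -wv.
  exact: nH eq.
- rewrite code_eq inE xpair_eqE; case: ifP => [/andP[/eqP-> /eqP->]//|_ /=].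
  exact: iH.
Qed.

Local Opaque link.

Definition zero (F : nat) h : Prop := forall x, hf h F x = 0.

Lemma mul_loop_spec h b (Q : hstate -> Prop) :
  input_ok h -> hr h rN = n -> hr h rI = 0 -> hr h rX = 0 ->
  zero fDeg h -> zero fHead h -> zero fSup h -> zero fRem h ->
  (forall h', input_ok h' -> mul_ok h' ->
     zero fDeg h' -> zero fHead h' -> zero fSup h' -> zero fRem h' -> Q h') ->
  n.+1 * ccost mul_loop <= b -> twp mul_loop h b Q.
Proof.
move=> ih eN eI eX zd zh zs zr HQ bb.
pose P k h := [/\ input_ok h, hr h rN = n, hr h rI = k & hr h rX = k * n] /\
  [/\ forall u, u < k -> hf h fMul u = u * n, zero fDeg h, zero fHead h, zero fSup h
    & zero fRem h].
apply: (@twp_for_body _ _ n P) bb => // [k h1 _ [[]]//|k h1 kn|h1].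
- move=> {ih eN eI eX zd zh zs zr} [[ih eN eI eX] [mh zd zh zs zr]].
  apply: twp_swp (leqnn _); rewrite /= /setr /updr /= eN eI eX.
  do !split=> //=; rewrite ?addn1 // ?mulSn 1?addnC // => u uk.
  by rewrite /updf /=; case: eqP => [->//|ne]; apply: mh; lia.
- by move=> [[ih1 _ _ _] [mh ? ? ? ?]]; apply: HQ => // u; apply: mh.
Qed.

Definition link_inv i h : Prop :=
  [/\ input_ok h, mul_ok h, links (halves i) h, hr h rI = i & zero fSup h /\ zero fRem h].

Lemma link_body_spec i h : i < m -> link_inv i h -> swp link_body h (link_inv i.+1).
Proof.
move=> im [ih mh lh ei [zs zr]]; have [u [v [su tv eq uv /halvesS eqt]]] := edge_atP im.
have eid : i = edge_id [set u; v] by rewrite -eq edge_atK.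
have [_ inp] := ih; have [iU iV] := inp _ im.
rewrite /= /setr /updr /= ei iU iV su tv; split=> [//|//|]; split=> [//|//|].
apply: (@link_spec 8 9 (halves i) u v) => //=; first exact: halves_new.
  by rewrite ei.
move=> h1 ih1 mh1 lh1 r1 s1 m1.
apply: (@link_spec 9 8 ((u, v) :: halves i) v u); rewrite ?r1 //=.
- by rewrite adj_sym.
- rewrite inE negb_or halves_new 1?setUC // andbT; apply/negP => /eqP[vu _].
  by move: (adj_neq uv); rewrite vu eqxx.
- by rewrite ei setUC.
move=> h2 ih2 mh2 lh2 r2 s2 m2; split=> [//|//|]; split=> //.
- by rewrite eqt.
- by rewrite /= r2 /= ei addn1.
- by split=> x; rewrite /= ?s2 ?s1 ?m2 ?m1 /= ?zs ?zr.
Qed.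

Lemma link_loop_spec h b (Q : hstate -> Prop) :
  link_inv 0 h -> (forall h', link_inv m h' -> Q h') ->
  m.+1 * ccost link_loop <= b -> twp link_loop h b Q.
Proof.
move=> inv0 HQ bb; apply: (@twp_for_body _ _ m link_inv) bb => //.
- by move=> k h' _ [[]].
- by move=> k h' km inv; apply: twp_swp (link_body_spec km inv) (leqnn _).
Qed.

Definition static h : Prop := [/\ input_ok h, mul_ok h & links (halves m) h].

(** A rule for any loop body: [ws] collects the common neighbours met so far and in the end lists
    all of them. Either endpoint may become [u] by the swap, hence the premises range over both
    orders. The factor 2 absorbs the initialization and the last test, as [min_deg] is positive. *)
Lemma traverse_spec body (J : 'I_n -> 'I_n -> seq 'I_n -> hstate -> Prop) h e b
    (Q : hstate -> Prop) :
  (forall u v ws h r x, r \in [:: rU; rV; rW; rX] -> J u v ws h -> J u v ws (setr h r x)) ->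
  e \in E -> static h -> hr h rE = edge_id e ->
  (forall u v, e = [set u; v] -> adj E u v -> J u v [::] h) ->
  (forall u v ws w h, e = [set u; v] -> adj E u v -> J u v ws h -> static h ->
     [/\ hr h rE = edge_id e, hr h rU = u, hr h rV = v & hr h rW = w.+1] ->
     adj E u w -> adj E v w -> w \notin ws ->
     swp body h (fun h' => [/\ J u v (w :: ws) h', static h' &
       [/\ hr h' rE = edge_id e, hr h' rU = u, hr h' rV = v & hr h' rW = w.+1]])) ->
  (forall u v ws h, e = [set u; v] -> adj E u v -> J u v ws h -> static h ->
     hr h rE = edge_id e -> uniq ws -> ws =i common_nbr E u v -> Q h) ->
  2 * ccost (traverse body) * min_deg E e <= b -> twp (traverse body) h b Q.
Proof.
move=> Jreg eE st eid J0 Jstep JQ bb.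
pose ok h u v := [/\ e = [set u; v], adj E u v, static h, hr h rE = edge_id e &
  hr h rU = u /\ hr h rV = v].
pose c := ccost (HWhile (HReg rW) (traverse_step body)).
have cE : ccost (traverse body) = ccost traverse_init + c by [].
apply: (@hwp_seq _ _ _ _ _ _ _ (ccost traverse_init) (c * (min_deg E e).+1)); last first.
  by have := min_deg_gt0 gE eE; move: bb; rewrite cE; nia.
apply: twp_swp (leqnn _).
pose start h := exists u v, [/\ ok h u v, deg E u <= deg E v, J u v [::] h
  & hr h rW = ptr (nbrs (halves m) u)].
have swp_start : swp traverse_init h start.
  have im := edge_id_lt eE; have [u [v [su tv eq uv _]]] := edge_atP im.
  rewrite edge_idK // in eq.
  have [[_ inp] mh lh] := st; have [iU iV] := inp _ im.
  have [dH hH _ _] := lh.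
  have Jsym : J v u [::] h by apply: J0; [rewrite eq setUC|rewrite adj_sym].
  have J0' := J0 u v eq uv.
  rewrite /= /updr /= eid iU iV su tv !dH !deg_nbrs.
  split=> //; split=> //; split=> [|duv|duv]; first by do !split.
    do 4!split=> //; exists v, u; split; last exact: hH.
    - by split=> //; rewrite 1?adj_sym // eq setUC.
    - lia.
    - by do ![apply/Jreg => //].
  split=> //; exists u, v; split; last exact: hH.
  - by [].
  - lia.
  - by do ![apply/Jreg => //].
apply: wpc_mono swp_start => h1 [u [v [[eq uv st1 eid1 [eu ev]] duv J1 ew]]].
have md : min_deg E e = deg E u by rewrite eq min_degE ?(adj_neq uv) //; lia.
pose I b h := exists ws pre rest, [/\ ok h u v, J u v ws h,
  nbrs (halves m) u = pre ++ rest /\ hr h rW = ptr rest,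
  uniq ws /\ (forall w, (w \in ws) = (w \in pre) && adj E v w)
  & c * (size rest).+1 <= b].
apply: (@twp_while _ _ I); last first.
  exists [::], [::], (nbrs (halves m) u); split=> //.
  by rewrite md deg_nbrs.
move=> {bb st eid J0 h J1 st1 eid1 eu ev ew h1}b' h.
case=> ws [pre [rest [[_ _ st eid [eu ev]] J1 [nbE ew] [uws wsE] bb]]].
split=> //= [w0|w0].
  split; first by move: bb; rewrite /c /ccost -/ccost; nia.
  apply: (JQ u v ws h) => // w; rewrite wsE inE -(adj_halves u w) -mem_nbrs nbE.
  case: rest ew {bb nbE} => [|r rest] ew; last by rewrite ew in w0.
  by rewrite cats0.
case: rest ew nbE bb => [|w rest] ew nbE bb; first by rewrite ew in w0.
exists (ccost (traverse_step body)), (c * (size rest).+1).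
split; first by move: bb; rewrite /= [in X in _ -> X]/c /ccost -/ccost /c /ccost -/ccost; nia.
apply: twp_swp (leqnn _).
have uw : adj E u w by rewrite -adj_halves -mem_nbrs nbE mem_cat mem_head orbT.
have wpre : w \notin pre.
  have := uniq_nbrs u (uniq_halves (leqnn m)).
  by rewrite nbE cat_uniq /= negb_or => /and3P[_ /andP[]].
have wE : hr h rW - 1 = w by rewrite ew subn1.
have nextI h1 ws' : ok h1 u v -> J u v ws' h1 -> hr h1 rW = w.+1 -> uniq ws' ->
    (forall x, (x \in ws') = (x \in rcons pre w) && adj E v x) ->
    swp (HSet rW (HGet fNext (HPlus (HGet fMul (HReg rU)) (HReg rW)))) h1
      (I (c * (size rest).+1)).
  move=> [_ _ st1 eid1 [eu1 ev1]] J1' ew1 uws' wsE'.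
  have [ih mh [_ _ nH _]] := st1.
  rewrite /= ew1 eu1 mh -/(code u w) (nH _ _ _ _ nbE).
  do !split=> //; first exact: code_in_codes.
  exists ws', (rcons pre w), rest; split=> //; last by rewrite cat_rcons.
  exact: Jreg.
rewrite /traverse_step; split=> [//|vw|vw]; move: vw; rewrite /= wE ev adj_testE adj_sym => vw.
  have {}vw : adj E v w by move: vw; case: (adj E v w).
  have wws : w \notin ws by rewrite wsE (negPf wpre) andFb.
  apply: wpc_mono (Jstep u v ws w h eq uv J1 st _ uw vw wws); last by split.
  move=> h1 [J2 st1 [eid1 eu1 ev1 ew1]]; apply: (nextI h1 (w :: ws)) => //.
    by rewrite /= wws.
  move=> x; rewrite inE wsE mem_rcons inE.
  by have [->|] := eqVneq x w; rewrite ?vw.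
apply: (nextI h ws) => // x; rewrite wsE mem_rcons inE.
have [->|//] := eqVneq x w; rewrite (negPf wpre) /=.
by move: vw; case: (adj E v w).
Qed.

Lemma support_size u v ws : adj E u v -> uniq ws -> ws =i common_nbr E u v ->
  support E [set u; v] = size ws.
Proof.
by move=> uv uws wsE; rewrite support_common_nbr // -(card_uniqP uws); apply: eq_card.
Qed.

Definition count_inv k h : Prop :=
  [/\ static h, hr h rE = k, zero fRem h, forall j, j < k -> hf h fLst j = j
    & forall j, j < m -> hf h fSup j = if j < k then support E (edge_at j) else 0].

Lemma count_step_spec k h : k < m -> count_inv k h ->
  twp count_step h (2 * ccost count_step * min_deg E (edge_at k)) (count_inv k.+1).
Proof.
move=> km [st ek zr lst sup]; set e := edge_at k.
have eE : e \in E := edge_at_in km.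
have eid : edge_id e = k := edge_atK km.
have cE : ccost count_step =
  ccost (HPut fLst (HReg rE) (HReg rE)) + (ccost (traverse count_body) + ccost (incr rE)).
  by [].
have md0 := min_deg_gt0 gE eE.
apply: (@hwp_seq _ _ _ _ _ _ _ (ccost (HPut fLst (HReg rE) (HReg rE)))
  (2 * ccost (traverse count_body) * min_deg E e + ccost (incr rE))); last first.
  by rewrite cE; nia.
apply: twp_swp (leqnn _); rewrite /= ek; split=> //.
set h1 := putf _ _ _ _.
apply: (@hwp_seq _ _ _ _ _ _ _ (2 * ccost (traverse count_body) * min_deg E e)
  (ccost (incr rE))); last exact: leqnn.
pose J (u v : 'I_n) (ws : seq 'I_n) h' := [/\ hf h' fSup k = size ws,
  forall j, j != k -> hf h' fSup j = hf h fSup j, zero fRem h'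
  & forall j, hf h' fLst j = hf h1 fLst j].
apply: (@traverse_spec _ J) (leqnn _) => //.
- by rewrite eid.
- by move=> u v _ _; split=> //; rewrite /h1 /= /updf /= sup // ltnn.
- move=> u v ws w h2 eq uv [s1 s2 zr2 l2] st2 [eid2 eu2 ev2 ew2] uw vw wws.
  rewrite /= eid2 eid; do !split=> //=.
  + by rewrite /updf /= eqxx s1 addn1.
  + by move=> j jk; rewrite /updf /= (negPf jk) s2.
move=> u v ws h2 eq uv [s1 s2 zr2 l2] st2 eid2 uws wsE.
apply: twp_swp (leqnn _); rewrite /= eid2 eid; do !split=> //=.
- by rewrite /updr /= addn1.
- move=> j jk; rewrite l2 /= /updf /=; case: eqP => [->//|jk']; apply: lst; lia.
- move=> j jm; have [->|jk] := eqVneq j k.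
    by rewrite ltnS leqnn s1 -/e eq (support_size uv uws wsE).
  by rewrite s2 // sup // ltnS [j <= k]leq_eqVlt (negPf jk).
Qed.

Lemma sum_edge_at (F : {set 'I_n} -> nat) :
  \sum_(0 <= k < m) F (edge_at k) = \sum_(e in E) F e.
Proof.
rewrite -[RHS]big_enum -(perm_big _ esE) (big_nth set0) size_map //.
Qed.

Lemma count_loop_spec h b (Q : hstate -> Prop) :
  count_inv 0 h -> (forall h', count_inv m h' -> Q h') ->
  4 * ccost count_loop * (\sum_(e in E) min_deg E e).+1 <= b -> twp count_loop h b Q.
Proof.
move=> inv0 HQ bb.
apply: (@twp_for _ _ m count_inv (fun k => 2 * ccost count_step * min_deg E (edge_at k))) => //.
- by move=> k h' _ [[[]]].
- by move=> k h' km; apply: count_step_spec.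
rewrite big_split /= -big_distrr /= sum_edge_at sum_nat_const_nat subn0.
have := card_le_sum_min_deg gE; rewrite card_edges.
move: bb; rewrite {1}/count_loop [ccost (HWhile _ _)]/ccost -!/ccost.
move: (\sum_(e in E) _) (tcost _) (ccost _) => D t c bb mD.
apply: leq_trans bb; nia.
Qed.

(** * Stack and list of edges during peeling *)

Local Notation edge_set := {set {set 'I_n}}.
Implicit Types (L M X : edge_set) (f g : {set 'I_n}) (stk : seq {set 'I_n}).

(* The remaining edges L are queued in the stack stk, or in the parts a0
   (already scanned in round k) and a1 (not yet scanned) of the list; only
   the edges in X may violate this. *)
Record queue L X stk (a0 a1 : seq {set 'I_n}) (k i : nat) h : Prop := Queue {
  q_static : static h;
  q_sub : L \subset E;
  q_rem : forall f, f \in E -> hf h fRem (edge_id f) = (f \notin L);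
  q_out : forall f, f \in E -> f \notin L -> is_trussness E f (hf h fOut (edge_id f));
  q_regs : [/\ hr h rS = size stk, hr h rK = k & hr h rI = i];
  q_regA : [/\ hr h rJ = size a0, hr h rA = i + size a1, size a0 <= i & i + size a1 <= m];
  q_uniq : uniq stk;
  q_stk_sub : {subset stk <= L};
  q_stk : forall x, x < size stk -> hf h fStk x = edge_id (nth set0 stk x);
  q_low : forall f, f \in stk -> hf h fSup (edge_id f) <= k;
  q_a0_sub : forall f, f \in a0 -> f \in E /\ k.+1 < min_deg E f;
  q_a0 : forall x, x < size a0 -> hf h fLst x = edge_id (nth set0 a0 x);
  q_a1_sub : forall f, f \in a1 -> f \in E /\ k <= min_deg E f;
  q_a1 : forall x, x < size a1 -> hf h fLst (i + x) = edge_id (nth set0 a1 x);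
  q_cover : forall f, f \in L -> f \notin X ->
    if hf h fSup (edge_id f) <= k then (f \in stk) || (f \in a1)
    else (f \in a0) || (f \in a1)
}.

Lemma size_uniq_edges (s : seq {set 'I_n}) : uniq s -> {subset s <= E} -> size s <= m.
Proof.
move=> us sE; rewrite -card_edges cardE; apply: uniq_leq_size us _ => f /sE.
by rewrite mem_enum.
Qed.

Lemma queue_stack_lt L X stk a0 a1 k i h f :
  queue L X stk a0 a1 k i h -> f \in L -> f \notin stk -> size stk < m.
Proof.
move=> q fL fstk; apply: (@size_uniq_edges (f :: stk)).
  by rewrite /= fstk (q_uniq q).
move=> g; rewrite inE => gs; apply: (subsetP (q_sub q)).
by case/predU1P: gs => [->//|/(q_stk_sub q)].
Qed.

Lemma push_spec r f L stk a0 a1 k i h (Q : hstate -> Prop) :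
  queue L [set f] stk a0 a1 k i h -> f \in L -> f \notin stk ->
  hf h fSup (edge_id f) <= k -> hr h r = edge_id f ->
  (forall h', queue L set0 (rcons stk f) a0 a1 k i h' -> hf h' fSup = hf h fSup ->
     (forall r', r' != rS -> hr h' r' = hr h r') -> Q h') ->
  swp (push r) h Q.
Proof.
move=> q fL fstk lowf ef HQ; have sm := queue_stack_lt q fL fstk.
case: q => st sub rem out [eS eK eI] [eJ eA ji im] us ss stk_ low s0 a0_ s1 a1_ cov.
rewrite /= eS ef; split=> //; split=> //; apply: HQ => //; last first.
  by move=> r'; case: r' => [|[|[|[|[|[|r']]]]]].
split=> //=.
- by split=> //; rewrite size_rcons /updr /= addn1.
- by rewrite rcons_uniq fstk.
- by move=> g; rewrite mem_rcons inE => /predU1P[->//|/ss].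
- move=> x; rewrite size_rcons ltnS nth_rcons /updf /= => xs.
  have [->|ne] := eqVneq x (size stk); first by rewrite ltnn.
  by rewrite ltn_neqAle ne xs stk_ // ltn_neqAle ne.
- by move=> g; rewrite mem_rcons inE => /predU1P[->//|/low].
move=> g gL _; rewrite mem_rcons inE; have [->|gf] /= := eqVneq g f; first by rewrite lowf.
by apply: cov => //; rewrite inE.
Qed.

Lemma queue_exempt L stk a0 a1 k i h f :
  queue L [set f] stk a0 a1 k i h ->
  (if hf h fSup (edge_id f) <= k then (f \in stk) || (f \in a1)
    else (f \in a0) || (f \in a1)) ->
  queue L set0 stk a0 a1 k i h.
Proof.
case=> ? ? ? ? ? ? ? ? ? ? ? ? ? ? cov fc; split=> // g gL _.
by have [->//|gf] := eqVneq g f; apply: cov; rewrite ?inE.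
Qed.

Local Opaque push.

Lemma decr_spec r f L stk a0 a1 k i h (Q : hstate -> Prop) :
  queue L set0 stk a0 a1 k i h -> f \in L ->
  0 < hf h fSup (edge_id f) -> hr h r = edge_id f ->
  (forall stk' h', queue L set0 stk' a0 a1 k i h' ->
     (forall g, g \in E -> hf h' fSup (edge_id g) = hf h fSup (edge_id g) - (g == f)) ->
     (forall r', r' != rS -> hr h' r' = hr h r') -> Q h') ->
  swp (decr r) h Q.
Proof.
move=> q fL pf ef HQ; have fE := subsetP (q_sub q) _ fL.
have [_ eK _] := q_regs q; have idm := edge_id_lt fE.
rewrite /= /updf /= ef !eqxx /= eK; split=> //.
set h1 := putf _ _ _ _.
have sup1 g : g \in E -> hf h1 fSup (edge_id g) = hf h fSup (edge_id g) - (g == f).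
  move=> gE'; rewrite /h1 /putf /updf /= edge_id_eq //.
  by case: eqP => [->//|_]; rewrite subn0.
have cov := q_cover q.
have q1 : queue L [set f] stk a0 a1 k i h1.
  case: q {cov HQ} => st sub rem out [eS _ eI] [eJ eA ji im] us ss stk_ low s0 a0_ s1 a1_ cov.
  split=> //.
    move=> g gs; rewrite sup1 ?(subsetP sub _ (ss _ gs)) //.
    by apply: leq_trans (low _ gs); rewrite leq_subr.
  move=> g gL; rewrite inE => gf; rewrite sup1 ?(subsetP sub) // (negPf gf) subn0.
  by apply: cov => //; rewrite inE.
(* Unless the new support is [k], the decrement does not cross the threshold and [f] is queued as
   before. If it is [k], it was [k.+1], so [f] was not on the stack, where supports are at most
   [k]. *)
split=> // [ne|eq0].
  apply: (HQ stk h1) => //; apply: queue_exempt q1 _.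
  rewrite sup1 // eqxx; have := cov f fL; rewrite inE => /(_ isT).
  move: ne pf; case: ifP => [|] le1 ne pf; case: ifP => le2 //; lia.
have sk : hf h fSup (edge_id f) = k.+1 by lia.
apply: (push_spec q1) => //.
- by apply/negP => /(q_low q); rewrite sk ltnn.
- by rewrite sup1 // eqxx sk subn1.
by move=> h' q' s' r'; apply: (HQ (rcons stk f)) => // g gE'; rewrite s' sup1.
Qed.

Local Opaque decr.

(** Marks the edges that have lost their triangle with [[set u; v]] so far; the test in [L] excludes
    triangles destroyed by earlier removals. *)
Definition touched L u v (ws : seq 'I_n) f : bool :=
  has (fun w => (w \in common_nbr L u v) && ((f == [set u; w]) || (f == [set v; w]))) ws.

(** The third vertex of a triangle is determined by two of its edges, so no edge is decremented
    twice in one traversal. *)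
Lemma touched_new L u v ws w : u != v -> w \notin ws -> w != u -> w != v ->
  ~~ touched L u v ws [set u; w] /\ ~~ touched L u v ws [set v; w].
Proof.
move=> uv wws wu wv; split; apply/hasPn => x xws; rewrite negb_and -implybE inE.
  apply/implyP => /andP[/adj_neq ux _]; apply/norP; split.
    by rewrite eq_set2l; apply: contraNneq wws => ->.
  apply/eqP => /set2_inj[[uv' _]|[ux' _]]; first by rewrite uv' eqxx in uv.
  by rewrite ux' eqxx in ux.
apply/implyP => /andP[_ /adj_neq vx]; apply/norP; split.
  apply/eqP => /set2_inj[[uv' _]|[ux' _]]; first by rewrite uv' eqxx in uv.
  by rewrite ux' eqxx in vx.
by rewrite eq_set2l; apply: contraNneq wws => ->.
Qed.

(** Makes the truncated subtraction in [decr] exact. *)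
Lemma support_gt0 L u v w : adj L u v -> w \in common_nbr L u v ->
  0 < support L [set u; w] /\ 0 < support L [set v; w].
Proof.
move=> uv; rewrite inE => /andP[uw vw].
rewrite !support_common_nbr //; split; apply/card_gt0P.
  by exists v; rewrite inE uv adj_sym.
by exists u; rewrite inE adj_sym uv adj_sym.
Qed.

Lemma queue_setr L X stk a0 a1 k i h r x : 6 < r ->
  queue L X stk a0 a1 k i h -> queue L X stk a0 a1 k i (setr h r x).
Proof.
by case: r => [|[|[|[|[|[|[|r]]]]]]] // _ [] *; split.
Qed.

(** In mid-traversal [e] is already flagged as removed, while the stored supports are still on their
    way from those in [L] to those in [L :\ e]. *)
Lemma peel_body_spec L e u v ws w stk a0 a1 k i h (Q : hstate -> Prop) :
  e = [set u; v] -> e \in L -> L \subset E ->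
  queue (L :\ e) set0 stk a0 a1 k i h ->
  (forall f, f \in L :\ e -> hf h fSup (edge_id f) = support L f - touched L u v ws f) ->
  [/\ hr h rU = u, hr h rV = v & hr h rW = w.+1] ->
  adj E u v -> adj E u w -> adj E v w -> w \notin ws ->
  (forall stk' h', queue (L :\ e) set0 stk' a0 a1 k i h' ->
     (forall f, f \in L :\ e ->
        hf h' fSup (edge_id f) = support L f - touched L u v (w :: ws) f) ->
     (forall r', r' \notin [:: rS; rF; rG] -> hr h' r' = hr h r') -> Q h') ->
  swp peel_body h Q.
Proof.
move=> eE eL LE q sup [eu ev ew] uv uw vw wws HQ.
have [[_ _] mh [_ _ _ idh]] := q_static q.
have idu : hf h fId (code u w) = edge_id [set u; w] by apply: idh; rewrite adj_halves.
have idv : hf h fId (code v w) = edge_id [set v; w] by apply: idh; rewrite adj_halves.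
have [wu wv] : w != u /\ w != v.
  by rewrite ![w == _]eq_sym (adj_neq uw) (adj_neq vw).
have uve := adj_neq uv.
have fe : [set u; w] != e by rewrite eE eq_set2l.
have ge : [set v; w] != e by rewrite eE [in X in _ != X]setUC eq_set2l.
have uwE := adj_in uw; have vwE := adj_in vw.
have uwm := edge_id_lt uwE; have vwm := edge_id_lt vwE.
have uvL : adj L u v by rewrite /adj /= uve -eE.
have wcE : (w \in common_nbr L u v) = ([set u; w] \in L :\ e) && ([set v; w] \in L :\ e).
  by rewrite !inE fe ge /adj /= ![_ == w]eq_sym wu wv.
rewrite /= /updr /= eu ev ew !mh -!/(code _ _) idu idv !(q_rem q) //.
split=> //; first by do !split=> //; apply: code_in_codes.
split=> //; first by do !split=> //; apply: code_in_codes.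
split=> // [rem|rem].
  apply: (HQ stk); first by do !apply: queue_setr.
  - move=> f fL; rewrite [hf _ _ _]/= sup // [touched _ _ _ (_ :: _) _]/= wcE.
    by move: rem; case: (_ \in L :\ e); case: (_ \in L :\ e).
  - by move=> r'; case: r' => [|[|[|[|[|[|[|[|[|[|[|[|[|r']]]]]]]]]]]]].
have [fL gL] : [set u; w] \in L :\ e /\ [set v; w] \in L :\ e.
  by move: rem; case: (_ \in L :\ e); case: (_ \in L :\ e).
have wc : w \in common_nbr L u v by rewrite wcE fL gL.
have [tf tg] := touched_new L uve wws wu wv.
have [pf pg] := support_gt0 uvL wc.
have fg : [set u; w] != [set v; w] by rewrite ![[set _; w]]setUC eq_set2l.
apply: (@decr_spec rF [set u; w] (L :\ e) stk a0 a1 k i) => //.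
- by do !apply: queue_setr.
- by rewrite /= sup // (negPf tf) subn0.
move=> stk1 h1 q1 sup1 r1.
have sup1' f : f \in L :\ e -> hf h1 fSup (edge_id f) =
    support L f - touched L u v ws f - (f == [set u; w]).
  by move=> fL'; rewrite sup1 ?(subsetP (q_sub q)) //= sup.
apply: (@decr_spec rG [set v; w] (L :\ e) stk1 a0 a1 k i) => //.
- by rewrite sup1' // (negPf tg) [_ == [set u; w]]eq_sym (negPf fg) !subn0.
- by rewrite r1.
move=> stk2 h2 q2 sup2 r2; apply: (HQ stk2) => //.
  move=> f fL'; rewrite sup2 ?(subsetP (q_sub q)) // sup1' // [touched _ _ _ (_ :: _) _]/= wc /=.
  have [->|fu] := eqVneq f [set u; w]; first by rewrite (negPf fg) (negPf tf) !subn0.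
  have [->|fv] := eqVneq f [set v; w]; first by rewrite (negPf tg) !subn0.
  by rewrite !subn0.
move=> r' nr; rewrite r2; last by apply: contraNneq nr => ->.
rewrite r1; last by apply: contraNneq nr => ->.
by move: nr; case: r' => [|[|[|[|[|[|[|[|[|[|[|[|[|r']]]]]]]]]]]]].
Qed.

(** While round [k] peels it, [L] need not be a k-truss itself; [m_ktruss] remembers the one with
    which the round began. *)
Record main_inv L stk (a0 a1 : seq {set 'I_n}) (k i : nat) h : Prop := MainInv {
  m_queue : queue L set0 stk a0 a1 k i h;
  m_sup : forall f, f \in L -> hf h fSup (edge_id f) = support L f;
  m_ktruss : exists2 M : edge_set, L \subset M & M \subset E /\ ktruss k M;
  m_max : forall M : edge_set, M \subset E -> ktruss k.+1 M -> M \subset L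
}.

Lemma edge_card f : f \in E -> #|f| = 2.
Proof. by case/andP: gE => /forall_inP E2 _ /E2/eqP. Qed.

(** By [m_max], a [k.+1]-truss through [e] would lie in [L] and force the support of [e] in [L]
    above [k], against [q_low]; the k-truss of [m_ktruss] contains [e]. *)
Lemma pop_trussness L e stk a0 a1 k i h :
  main_inv L (rcons stk e) a0 a1 k i h ->
  is_trussness E e k /\ (forall M : edge_set, M \subset E -> ktruss k.+1 M -> e \notin M).
Proof.
case=> q sup [B LB [BE kB]] max.
have estk : e \in rcons stk e by rewrite mem_rcons mem_head.
have eL := q_stk_sub q estk.
have nM (M : edge_set) : M \subset E -> ktruss k.+1 M -> e \notin M.
  move=> ME kM; apply/negP => eM; have := ktrussP _ _ kM _ eM.
  have := supportS e (max M ME kM); rewrite -(sup e eL); have := q_low q estk; lia.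
by split=> //; apply: (is_trussness_intro edge_card BE kB _ nM); apply: (subsetP LB).
Qed.

Lemma pop_init_spec L e stk a0 a1 k i h (Q : hstate -> Prop) :
  main_inv L (rcons stk e) a0 a1 k i h ->
  (forall h', queue (L :\ e) set0 stk a0 a1 k i h' -> hr h' rE = edge_id e ->
     hf h' fSup = hf h fSup -> Q h') ->
  swp pop_init h Q.
Proof.
move=> mi HQ; have [tr _] := pop_trussness mi; have q := m_queue mi.
have estk : e \in rcons stk e by rewrite mem_rcons mem_head.
have eL := q_stk_sub q estk; have eE := subsetP (q_sub q) _ eL.
have em := edge_id_lt eE.
have sm : size stk < m.
  have := size_uniq_edges (q_uniq q); rewrite size_rcons; apply=> f.
  by move/(q_stk_sub q); apply: (subsetP (q_sub q)).
case: q => st sub rem out [eS eK eI] [eJ eA ji im] us ss stk_ low s0 a0_ s1 a1_ cov.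
rewrite size_rcons in eS.
have top : hf h fStk (size stk) = edge_id e.
  by rewrite stk_ ?size_rcons // nth_rcons ltnn eqxx.
rewrite /= /updr /= eS subn1 /= top eK; split=> //; split=> //; split=> //; split=> //.
have [enstk us'] : e \notin stk /\ uniq stk by move: us; rewrite rcons_uniq => /andP[].
apply: HQ => //; split=> //=.
- by apply: subset_trans sub; apply: subsetDl.
- move=> f fE; rewrite /updf /= edge_id_eq // !inE.
  by case: eqP => [->|_] //=; rewrite rem.
- move=> f fE; rewrite /updf /= edge_id_eq // !inE negb_and negbK.
  by have [->|_] := eqVneq f e; [|apply: out].
- move=> f fs; rewrite !inE (ss f) ?mem_rcons ?inE ?fs ?orbT // andbT.
  by apply: contraNneq enstk => <-.
- by move=> x xs; rewrite /updf /= stk_ ?nth_rcons ?xs // size_rcons ltnS ltnW.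
- by move=> f fs; apply: low; rewrite mem_rcons inE fs orbT.
move=> f; rewrite !inE => /andP[fe fL] _.
have := cov f fL; rewrite inE => /(_ isT).
by rewrite mem_rcons inE (negPf fe).
Qed.

Local Opaque pop_init peel_body.

Lemma pop_spec L e stk a0 a1 k i h b (Q : hstate -> Prop) :
  main_inv L (rcons stk e) a0 a1 k i h ->
  (forall stk' h', main_inv (L :\ e) stk' a0 a1 k i h' -> Q h') ->
  2 * ccost (pop_init ;; traverse peel_body) * min_deg E e <= b ->
  twp (pop_init ;; traverse peel_body) h b Q.
Proof.
move=> mi HQ bb; have [tr nM] := pop_trussness mi.
have [q sup [B LB [BE kB]] max] := mi.
have estk : e \in rcons stk e by rewrite mem_rcons mem_head.
have eL := q_stk_sub q estk; have LE := q_sub q; have eE := subsetP LE _ eL.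
have cE : ccost (pop_init ;; traverse peel_body) =
  ccost pop_init + ccost (traverse peel_body) by [].
apply: (@hwp_seq _ _ _ _ _ _ _ (ccost pop_init)
  (2 * ccost (traverse peel_body) * min_deg E e)); last first.
  apply: leq_trans bb; rewrite cE; have := min_deg_gt0 gE eE; clear.
  by move: (ccost _) (ccost _) (min_deg E e) => c d md; nia.
apply: twp_swp (leqnn _); apply: (pop_init_spec mi) => h1 q1 e1 s1.
pose J u v ws h := exists2 stk, queue (L :\ e) set0 stk a0 a1 k i h &
  forall f, f \in L :\ e -> hf h fSup (edge_id f) = support L f - touched L u v ws f.
apply: (@traverse_spec _ J) (leqnn _).
- by move=> u v ws h2 r x; rewrite !inE => /or4P[]/eqP-> [stk2 q2 s2];
    (exists stk2; [apply: queue_setr q2|exact: s2]).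
- exact: eE.
- exact: q_static q1.
- exact: e1.
- move=> u v _ _; exists stk; first exact: q1.
  by move=> f; rewrite !inE => /andP[_ fL]; rewrite s1 sup // subn0.
- move=> u v ws w h2 eq uv [stk2 q2 s2] st2 [ei eu ev ew] uw vw wws.
  apply: (peel_body_spec eq eL LE q2 s2 _ uv uw vw wws); first by [].
  move=> stk3 h3 q3 s3 r3; split; [by exists stk3|exact: q_static q3|].
  by split; rewrite r3.
move=> u v ws h2 eq uv [stk2 q2 s2] st2 ei uws wsE; apply: (HQ stk2); split; first exact: q2.
- move=> f fL'; move: (fL'); rewrite !inE => /andP[fe fL].
  have uvL : adj L u v by rewrite /adj /= (adj_neq uv) -eq.
  (* All common neighbours in [E] have been visited, so [touched] tells exactly whether [f] lost the
     one triangle it can lose. *)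
  rewrite s2 // (@support_remove _ L e f) ?edge_card ?(subsetP LE) // eq.
  rewrite union_triangle ?edge_card ?(subsetP LE) // -?eq //.
  suff -> : touched L u v ws f =
    [exists w in common_nbr L u v, (f == [set u; w]) || (f == [set v; w])] by rewrite addnK.
  apply/hasP/exists_inP => [[w _ /andP[wc fw]]|[w wc fw]]; exists w => //; last by rewrite wc.
  by rewrite wsE; move: wc; rewrite !inE => /andP[/(adjS LE)-> /(adjS LE)->].
- by exists B => //; apply: subset_trans LB; apply: subsetDl.
- by move=> M ME kM; rewrite subsetD1 max // nM.
Qed.

Lemma scan_spec L f a0 a1 k i h (Q : hstate -> Prop) :
  main_inv L [::] a0 (f :: a1) k i h ->
  (forall stk' a0' h', main_inv L stk' a0' a1 k i.+1 h' ->
     a0' = a0 \/ a0' = rcons a0 f -> Q h') ->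
  swp scan h Q.
Proof.
move=> [q sup low max] HQ.
have [eS eK eI] := q_regs q; have [eJ eA ji im] := q_regA q.
have [fE kf] := q_a1_sub q (mem_head f a1).
have ei : hf h fLst i = edge_id f by rewrite -[i]addn0 (q_a1 q).
have im' : i < m by move: im => /=; lia.
have jm : size a0 < m by lia.
have fm := edge_id_lt fE.
have q1 : queue L [set f] [::] a0 a1 k i.+1 (setr (setr h rE (edge_id f)) rI i.+1).
  case: q => st sub rem out [_ _ _] _ us ss stk_ lo s0 a0_ s1 a1_ cov.
  split; try by [].
  - by split=> //=; [rewrite /updr /= eA /= addnS|exact: leqW|rewrite addSnnS].
  - by move=> g ga; apply: s1; rewrite inE ga orbT.
  - by move=> x xs; have := a1_ x.+1 xs; rewrite /= addnS.
  - move=> g gL; rewrite inE => gf; have := cov g gL.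
    by rewrite !inE (negPf gf) => /(_ isT).
rewrite /= /updr /= eI ei addn1 (q_rem q) // eK eJ; split; [by []|by []|].
split; [by []|by []|]; split; [by []| |].
  move=> fL; have {}fL : f \notin L by move: fL; case: (f \in L).
  apply: (HQ [::] a0); last by left.
  split; [|exact: sup|exact: low|exact: max].
  case: q1 => st sub rem out rs ra us ss stk_ lo s0 a0_ s1 a1_ cov.
  split; try by [].
  move=> g gL _; apply: cov => //; rewrite inE.
  by apply: contraNneq fL => <-.
move=> fL; have {}fL : f \in L by move: fL; case: (f \in L).
rewrite sup //; split; [by []| |].
  move=> kf'; have {}kf' : k < support L f by lia.
  split; [by []|by []|exact: jm|].
  split; [by []|by []|].
  apply: (HQ [::] (rcons a0 f)); last by right.
  split; [|exact: sup|exact: low|exact: max].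
  case: q1 => st sub rem out rs ra us ss stk_ lo s0 a0_ s1 a1_ cov.
  split; try by [].
  - by case: ra => _ eA1 ji1 im1; split; rewrite ?size_rcons //= /updr /= ?addn1.
  - move=> g; rewrite mem_rcons inE => /predU1P[->|/s0//]; split=> //.
    (* Support above [k] lets [f] be charged for a scan in the next round, even if it is removed
       meanwhile. *)
    by have := support_lt_min_deg gE (q_sub q) fL; lia.
  - move=> x; rewrite size_rcons ltnS nth_rcons /= /updf /= => xs.
    have [->|ne] := eqVneq x (size a0); first by rewrite ltnn.
    by rewrite ltn_neqAle ne xs /= a0_ // ltn_neqAle ne.
  (* The write position is at most [i], so the unread entries, from [i.+1] on, survive. *)
  - move=> x xs; rewrite /= /updf /=; have -> : (i.+1 + x == size a0) = false by lia.
    exact: a1_.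
  - move=> g gL _; have [->|gf] := eqVneq g f.
      by rewrite /= /updf /= sup // leqNgt kf' /= mem_rcons mem_head.
    have := cov g gL; rewrite inE => /(_ gf); rewrite mem_rcons inE (negPf gf) /=.
    by [].
move=> kf'; have {}kf' : support L f <= k by lia.
apply: (push_spec q1) => //; first by rewrite /= sup.
move=> h' q' s' _; apply: (HQ [:: f] a0 h'); last by left.
split; [exact: q'| |exact: low|exact: max].
by move=> g gL; rewrite s' /= sup.
Qed.

(** With the stack empty and all edges scanned, [q_cover] leaves only supports above [k]: [L] is now
    a [k.+1]-truss and is the witness for the next round. *)
Lemma next_round_spec L a0 k i h (Q : hstate -> Prop) :
  main_inv L [::] a0 [::] k i h ->
  (forall h', main_inv L [::] [::] a0 k.+1 0 h' -> Q h') ->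
  swp next_round h Q.
Proof.
move=> [q sup low max] HQ.
have [eS eK eI] := q_regs q; have [eJ eA ji im] := q_regA q.
have kL f : f \in L -> f \in a0 /\ k < support L f.
  move=> fL; have := q_cover q fL; rewrite inE => /(_ isT); rewrite (sup f fL).
  by case: leqP => //; rewrite orbF.
rewrite /= /updr /= eK addn1; do 4 (split; [by []|by []|]).
apply: HQ; split; [|exact: sup| |].
- case: q => st sub rem out [_ _ _] _ us ss stk_ lo s0 a0_ s1 a1_ cov.
  split; try by [].
  + by split=> //=; rewrite add0n; lia.
  + by move=> f /s0[fE kf]; split=> //; apply: ltnW.
  + by move=> f fL _; rewrite /= (kL f fL).1; case: ifP.
- by exists L => //; split; [exact: q_sub q|apply/ktrussP => f /kL[]].
by move=> M ME kM; apply: max => //; apply: ktruss_leq kM.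
Qed.

Local Opaque scan next_round.

(** The sum over [L] pays for removals. A listed edge pays for one scan in each round up to its
    minimum degree, the current round included if its scan is still due. Because of the factor 2, a
    scan can also fund the unit for [0 < i], which later pays for the change of round. *)
Definition potential L (a0 a1 : seq {set 'I_n}) (k i : nat) : nat :=
  2 * (\sum_(f in L) min_deg E f + \sum_(f <- a0) (min_deg E f - k) +
       \sum_(f <- a1) ((min_deg E f).+1 - k)) + (0 < i).

Lemma main_loop_spec L stk a0 a1 k i h b (Q : hstate -> Prop) :
  main_inv L stk a0 a1 k i h ->
  (forall h', (forall f, f \in E -> is_trussness E f (hf h' fOut (edge_id f))) -> Q h') ->
  ccost main_loop * (potential L a0 a1 k i).+1 <= b ->
  twp main_loop h b Q.
Proof.
move=> mi0 HQ bb.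
pose I b h := exists L stk a0 a1 k i,
  main_inv L stk a0 a1 k i h /\ ccost main_loop * (potential L a0 a1 k i).+1 <= b.
apply: (@twp_while _ _ I); last by exists L, stk, a0, a1, k, i.
move=> {L stk a0 a1 k i h b mi0 bb} b h [L [stk [a0 [a1 [k [i [mi bb]]]]]]].
have [q sup _ _] := mi.
have [eS eK eI] := q_regs q; have [eJ eA ji im] := q_regA q.
set guard := HPlus (HReg rS) (HReg rA).
set test := HMinus (HReg rA) (HReg rI).
pose tr := traverse peel_body.
have cE : ccost main_loop = tcost guard + (tcost (HReg rS) +
    (ccost (pop_init ;; tr) + (tcost test + (ccost scan + ccost next_round)))) by [].
split; [by []| |].
  rewrite /guard /= eS eA => s0; split.
    by apply: leq_trans bb; rewrite mulnS {1}cE -!addnA leq_addr.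
  have stk0 : stk = [::] by apply: size0nil; lia.
  have a00 : a0 = [::] by apply: size0nil; lia.
  have a10 : a1 = [::] by apply: size0nil; lia.
  apply: HQ => f fE; apply: (q_out q) => //; apply/negP => fL.
  have := q_cover q fL; rewrite stk0 a00 a10 !inE => /(_ isT).
  by case: ifP.
rewrite /guard /= eS eA -/guard => ne0.
case/lastP: stk => [|stk e] in mi q eS ne0 *.
  have ra0 : hr h rS = 0 by rewrite eS.
  case: a1 => [|f a1] in mi q bb eA im ne0 *.
    exists (tcost (HReg rS) + (tcost test + ccost next_round)),
      (ccost main_loop * (potential L [::] a0 k.+1 0).+1); split.
      have i0 : 0 < i by move: ne0; rewrite /=; lia.
      apply: leq_trans bb.
      (* Scanned edges of round [k] are worth as much as unscanned ones of round [k.+1], so only the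
         unit for [0 < i] is spent. *)
      have -> : potential L a0 [::] k i = (potential L [::] a0 k.+1 0).+1.
        rewrite /potential i0 !big_nil (eq_bigr (fun f => (min_deg E f).+1 - k.+1)).
          by rewrite !addn0 addn1.
        by move=> f _; rewrite subSS.
      by rewrite [in X in _ <= X]mulnS leq_add2r cE; clear; lia.
    apply: (@twp_if _ _ _ _ 0 (tcost test + ccost next_round)) => //.
      by rewrite /= ra0.
    move=> _; apply: (@twp_if _ _ _ _ 0 (ccost next_round)) => //.
      by rewrite /= eA eI addn0 subnn.
    move=> _; apply: twp_swp (leqnn _); apply: (next_round_spec mi) => h' mi'.
    by exists L, [::], [::], a0, k.+1, 0.
  have [fE kf] := q_a1_sub q (mem_head f a1).
  exists (tcost (HReg rS) + (tcost test + ccost scan)),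
      (ccost main_loop * (potential L a0 (f :: a1) k i)).
  split.
    by apply: leq_trans bb; rewrite mulnS cE; clear; lia.
  apply: (@twp_if _ _ _ _ 0 (tcost test + ccost scan)) => //.
    by rewrite /= ra0.
  move=> _; apply: (@twp_if _ _ _ _ (ccost scan) 0) => //; last first.
    by rewrite /= eA eI /=; lia.
  move=> _; apply: twp_swp (leqnn _); apply: (scan_spec mi) => stk' a0' h' mi' a0E.
  exists L, stk', a0', a1, k, i.+1; split; first exact: mi'.
  rewrite leq_mul2l; apply/orP; right.
  rewrite /potential big_cons; case: a0E => ->;
    rewrite -?cats1 ?big_cat ?big_seq1 /=; move: kf; clear;
    move: (\sum_(f in L) _) (\sum_(f <- a0) _) (\sum_(f <- a1) _) (min_deg E f);
    by case: i => [|i] x y z d kf; rewrite ?ltnn ?ltn0Sn; lia.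
exists (tcost (HReg rS) + 2 * ccost (pop_init ;; tr) * min_deg E e),
  (ccost main_loop * (potential (L :\ e) a0 a1 k i).+1).
have eL : e \in L by apply: (q_stk_sub q); rewrite mem_rcons mem_head.
have md0 := min_deg_gt0 gE (subsetP (q_sub q) _ eL).
split.
  apply: leq_trans bb; rewrite /potential (big_setD1 e eL) /= cE.
  move: md0; clear; move: (\sum_(f in _) _) (\sum_(f <- a0) _) (\sum_(f <- a1) _).
  move: (ccost _) (ccost _) (ccost _) (tcost _) (tcost _) (tcost _) (min_deg E e) (0 < i).
  move=> c1 c2 c3 t1 t2 t3 md [] x y z; nia.
apply: (@twp_if _ _ _ _ (2 * ccost (pop_init ;; tr) * min_deg E e) 0) => //.
- move=> _; apply: (pop_spec mi) (leqnn _) => stk' h' mi'.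
  by exists (L :\ e), stk', a0, a1, k, i.
- by rewrite /= eS size_rcons.
- by rewrite addn0.
Qed.

Lemma main_init_spec h (Q : hstate -> Prop) : count_inv m h ->
  (forall h', main_inv E [::] [::] (edges_of es) 0 0 h' -> Q h') -> swp main_init h Q.
Proof.
move=> [st _ zr lst sup] HQ; have [[em _] _ _] := st.
rewrite /= /updr /=; do 5 (split; [by []|by []|]).
have ses : size (edges_of es) = m by rewrite size_map.
apply: HQ; split.
- split; try by [].
  + by move=> f fE; rewrite zr fE.
  + by move=> f ->.
  + by rewrite ses em.
  + by move=> f; rewrite mem_edges.
  + by move=> x; rewrite ses => xm; rewrite /= lst // -[nth _ _ _]/(edge_at x) edge_atK.
  + by move=> f fE _; rewrite mem_edges fE orbT if_same.
- by move=> f fE; rewrite /= sup ?edge_id_lt // edge_idK.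
- by exists E => //; split=> //; apply/ktrussP.
- by [].
Qed.

Local Opaque main_init.

Lemma potential_init : potential E [::] (edges_of es) 0 0 <= 6 * \sum_(e in E) min_deg E e.
Proof.
have eE F : \sum_(e <- edges_of es) F e = \sum_(e in E) F e.
  by rewrite (perm_big _ esE) big_enum.
rewrite /potential big_nil eE.
have -> : \sum_(e in E) ((min_deg E e).+1 - 0) = \sum_(e in E) min_deg E e + #|E|.
  by rewrite -sum1_card -big_split; apply: eq_bigr => e _; rewrite /= subn0 addn1.
have := card_le_sum_min_deg gE; lia.
Qed.

Lemma truss_prog_spec h :
  input_ok h -> hr h rN = n -> zero fDeg h -> zero fHead h -> zero fSup h -> zero fRem h ->
  0 < m ->
  twp truss_prog h (8 * ccost truss_prog * \sum_(e in E) min_deg E e)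
    (fun h' => forall f, f \in E -> is_trussness E f (hf h' fOut (edge_id f))).
Proof.
move=> ih eN zd zh zs zr m0.
have mD := card_le_sum_min_deg gE; have nm := graph_card_vertices gE.
rewrite card_ord card_edges in nm; rewrite card_edges in mD.
have pD := potential_init; set p := potential _ _ _ _ _ in pD.
pose c r := ccost (HSet r (HCst 0)).
have cE : ccost truss_prog = c rI + (c rX + (ccost mul_loop + (c rI + (ccost link_loop +
  (c rE + (ccost count_loop + (ccost main_init + ccost main_loop))))))) by [].
set D := \sum_(e in E) min_deg E e in mD pD *.
apply: (@hwp_weaken _ _ _ _ _ _ (c rI + (c rX + (n.+1 * ccost mul_loop + (c rI +
  (m.+1 * ccost link_loop + (c rE + (4 * ccost count_loop * D.+1 +
  (ccost main_init + ccost main_loop * p.+1)))))))) _ _); last first.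
- by move=> h'; exact.
(* The factor 8 covers every phase: [4 * D.+1] for counting and at most [6 * D + 1] for the main
   loop, with [D] positive; [n <= 2 * m] and [m <= D] bound the rest. *)
- rewrite cE; move: (c rI) (c rX) (c rE) (ccost mul_loop) (ccost link_loop).
  move: (ccost count_loop) (ccost main_init) (ccost main_loop) mD nm pD m0; clear.
  move: D p => D p x1 x2 x3 mD nm pD m0 x4 x5 x6 x7 x8.
  rewrite [8 * _]mulnC -[leqRHS]mulnA !(mulnDl _ _ (8 * D)).
  have le x y : x <= 8 * D -> x * y <= y * (8 * D).
    by move=> xD; rewrite [leqRHS]mulnC leq_mul2r xD orbT.
  have le1 y : y <= y * (8 * D) by rewrite -{1}[y]mul1n; apply: le; lia.
  have l1 : n.+1 * x7 <= x7 * (8 * D) by apply: le; lia.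
  have l2 : m.+1 * x8 <= x8 * (8 * D) by apply: le; lia.
  have l3 : 4 * x1 * D.+1 <= x1 * (8 * D) by rewrite mulnAC; apply: le; lia.
  have l4 : x3 * p.+1 <= x3 * (8 * D) by rewrite mulnC; apply: le; lia.
  by do 8![apply: leq_add; first by rewrite ?le1].
apply: (hwp_seq _ (leqnn _)); apply: twp_swp (leqnn _); split=> //.
apply: (hwp_seq _ (leqnn _)); apply: twp_swp (leqnn _); split=> //.
apply: (hwp_seq _ (leqnn _)).
apply: (mul_loop_spec _ _ _ _ _ _ _ _ _ (leqnn _)) => // h1 ih1 mh1 zd1 zh1 zs1 zr1.
apply: (hwp_seq _ (leqnn _)); apply: twp_swp (leqnn _); split=> //.
apply: (hwp_seq _ (leqnn _)); apply: (link_loop_spec _ _ (leqnn _)).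
  have h0 : halves 0 = [::] by rewrite /halves take0.
  split=> //; split=> [u|u|u pre w rest|u w]; rewrite h0 ?zd1 ?zh1 //.
  by case: pre.
move=> h2 [ih2 mh2 lh2 _ [zs2 zr2]].
apply: (hwp_seq _ (leqnn _)); apply: twp_swp (leqnn _); split=> //.
apply: (hwp_seq _ (leqnn _)); apply: (count_loop_spec _ _ (leqnn _)).
  by split=> [|//|//|//|j _]; [split|apply: zs2].
move=> h3 inv3; apply: (hwp_seq _ (leqnn _)); apply: twp_swp (leqnn _).
by apply: (main_init_spec inv3) => h4 mi; apply: (main_loop_spec mi _ (leqnn _)).
Qed.

End Correctness.


(** * The compiled program on the machine input *)

Lemma nth_endpoints n (s : seq ('I_n * 'I_n)) i :
  let t := flatten [seq [:: val p.1; val p.2] | p <- s] in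
  nth 0 t (2 * i) = nth 0 [seq val p.1 | p <- s] i /\
  nth 0 t (2 * i).+1 = nth 0 [seq val p.2 | p <- s] i.
Proof.
elim: s i => [|p s IH] i t; first by rewrite /t !nth_nil.
by case: i => [//|i]; rewrite mulnS; apply: IH.
Qed.

Lemma size_endpoints n (s : seq ('I_n * 'I_n)) :
  size (flatten [seq [:: val p.1; val p.2] | p <- s]) = 2 * size s.
Proof. by elim: s => //= p s ->; rewrite mulnS. Qed.

(** The two loads are written directly for the machine, since compiled code presupposes [m] in
    register 0 and [wpc] forbids assigning it. *)
Definition truss_cmd : cmd :=
  Seq (Assign 0 (Deref (Cst 1))) (Seq (Assign 1 (Deref (Cst 0))) (ccmd truss_prog)).

Section Program.
Variables (n : nat) (E : {set {set 'I_n}}) (es : seq ('I_n * 'I_n)).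
Hypotheses (gE : graph E) (esE : edge_listing E es).

Definition start_hstate : hstate :=
  HState (updr (updr (fun=> 0) 0 (size es)) 1 n)
    (fun f x => if f == 0 then src es x else if f == 1 then tgt es x else 0).

Lemma start_rep (s : state) :
  reg s = upd (upd (fun=> 0) 0 (size es)) 1 n -> cell s = cell (input es) ->
  rep (size es) (dom es) s start_hstate.
Proof.
move=> rE cE; split.
- by rewrite rE => -[|[|r]].
- by rewrite rE.
move=> f x d; rewrite cE /addr.
(* Cells beyond the input are zero, so all fields but the endpoints start at zero. *)
have pad a : 2 + 2 * size es <= a -> cell (input es) a = 0.
  by move=> le; apply: nth_default; rewrite /= size_endpoints.
have [e1 e2] := nth_endpoints es x.
case: f d => [|[|f]] d; rewrite /fcst /fcoef /fstride [nth _ _ _]/= [nth 3 _ _]/= [nth 12 _ _]/=.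
- by rewrite (_ : _ + _ = (2 * x).+2); [exact: e1|lia].
- by rewrite (_ : _ + _ = (2 * x).+3); [exact: e2|lia].
- apply: pad; case: f {d} => [|f]; first by rewrite /=; lia.
  by rewrite /= !nth_default //=; lia.
Qed.

Lemma truss_cmd_spec : 0 < #|E| -> exists s t l,
  [/\ exec (adj_test E) truss_cmd (input es) s t l,
      forall i, i < #|E| -> is_trussness E (nth set0 (edges_of es) i) (output #|E| s i),
      cells_used l <= 19 * #|E|
    & t <= 6 + 8 * ccost truss_prog * \sum_(e in E) min_deg E e].
Proof.
rewrite (card_edges esE) => m0.
pose s1 := State (upd (fun=> 0) 0 (size es)) (cell (input es)).
pose s2 := State (upd (upd (fun=> 0) 0 (size es)) 1 n) (cell (input es)).
have ex1 : exec (adj_test E) (Assign 0 (Deref (Cst 1))) (input es) s1 3 [:: 1].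
  exact: (ExAssign _ 0 (Deref (Cst 1)) (input es)).
have ex2 : exec (adj_test E) (Assign 1 (Deref (Cst 0))) s1 s2 3 [:: 0].
  exact: (ExAssign _ 1 (Deref (Cst 0)) s1).
have ih : input_ok es start_hstate by split.
have z f : 1 < f -> zero f start_hstate by case: f => [|[|f]].
have [s [t [l [ex lok tb [h' [_ _ cE] H]]]]] :=
  truss_prog_spec gE esE ih erefl (z fDeg isT) (z fHead isT) (z fSup isT) (z fRem isT) m0
    (@start_rep s2 erefl erefl).
exists s, (3 + (3 + t)), ([:: 1] ++ [:: 0] ++ l); split.
- by apply: ExSeq ex1 _; apply: ExSeq ex2 _.
- move=> i im; have dm : dom es 2 i by [].
  have -> : output (size es) s i = hf h' 2 i.
    by rewrite /output -(cE _ _ dm) /addr /fcst /fcoef /fstride /= mul1n.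
  by rewrite -{2}(edge_atK esE im); apply: H; apply: edge_at_in.
- have nm := graph_card_vertices gE; rewrite card_ord (card_edges esE) in nm.
  apply: (@leq_trans (size (cells es))).
    apply: uniq_leq_size (undup_uniq _) _ => a; rewrite mem_undup !inE.
    by case/or3P => [/eqP->|/eqP->|/lok//]; rewrite /cells mem_cat.
  (* [2 + 11 * m + 3 * n] is at most [19 * m], as [n <= 2 * m] and [m] is positive. *)
  rewrite size_cells; lia.
- by rewrite addnA leq_add2l.
Qed.

End Program.

Import Order.TTheory GRing.Theory Num.Theory.
Local Open Scope ring_scope.

Theorem theorem1p2 :
  (exists (P : cmd) (C : nat),
     forall (n : nat) (E : {set {set 'I_n}}) (es : seq ('I_n * 'I_n)),
     graph E -> (0 < #|E|)%N -> edge_listing E es ->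
     exists (s : state) (t : nat) (l : seq nat),
       [/\ exec (adj_test E) P (input es) s t l,
           forall i : nat, (i < #|E|)%N ->
             is_trussness E (nth set0 (edges_of es) i) (output #|E| s i),
           (cells_used l <= C * #|E|)%N
         & t%:R <= C%:R * (#|E|%:R * avg_degeneracy E) :> rat])
  /\
  (exists C : nat,
     forall (n : nat) (E : {set {set 'I_n}}),
     graph E ->
     #|E|%:R * avg_degeneracy E <= C%:R * (#|E|%:R * (arboricity E)%:R) :> rat)
  /\
  (exists C : nat,
     forall (R : rcfType) (n : nat) (E : {set {set 'I_n}}),
     graph E ->
     #|E|%:R * (arboricity E)%:R <= C%:R * Num.sqrt (#|E|%:R ^+ 3) :> R).
Proof.
split; last split.
- have := truss_cmd_spec; move: (ccost truss_prog) => K spec.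
  (* 19 serves the space bound; 6 is the cost of the two initial loads, absorbed because the sum of
     minimum degrees is positive. *)
  exists truss_cmd, (19 + (6 + 8 * K))%N => n E es gE m0 esE.
  have [s [t [l [ex out cells time]]]] := spec n E es gE esE m0.
  exists s, t, l; split; [exact: ex|exact: out|by rewrite mulnDl (leq_trans cells) ?leq_addr|].
  rewrite avg_degeneracyE // -natrM ler_nat.
  have D0 : (0 < \sum_(e in E) min_deg E e)%N := leq_trans m0 (card_le_sum_min_deg gE).
  apply: leq_trans time _; rewrite mulnDl (leq_trans _ (leq_addl _ _)) // mulnDl.
  by rewrite leq_add2r leq_pmulr.
- exists 2 => n E gE; rewrite avg_degeneracyE // -!natrM ler_nat.
  exact: sum_min_deg_arboricity.
- by exists 2 => R n E gE; apply: arboricity_sqrt_leq.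
Qed.
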